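(* In the multi-agent setting described in the context (differentiable convex functions $f_i$, closed convex sets $H_i$, communication graphs $\mathcal{G}(t)$, and the closed-loop continuous-time system given there), suppose that the graph $\mathcal{G}(t)$ is balanced for all $t\ge 0$ and that the following hold: (i) for each $i\in\mathcal{I}$, the set $X_i=\{x\in\mathbb{R}^r\mid \nabla f_i(x)=0\}$ is nonempty and bounded; (ii) $H=\bigcap_{i=1}^n H_i\neq\emptyset$; (iii) the length of the time interval between any two contiguous switching times of $\mathcal{G}(t)$ is no smaller than a given constant $d_w>0$; (iv) there exist a constant $M>d_w$ and an infinite sequence $t_0,t_1,t_2,\ldots$ of switching times of $\mathcal{G}(t)$ such that $t_0=0$, $0<t_{j+1}-t_j\le M$, and the union of all the graphs during each interval $[t_j,t_{j+1})$ is strongly connected, for all integers $j\ge 0$. Then, for arbitrary initial conditions $x_i(0)\in\mathbb{R}^r$ and $q_i(0)>0$, $i\in\mathcal{I}$, for the closed-loop system all agents reach a consensus, i.e., $\lim_{t\to+\infty}[x_i(t)-x^*(t)]=0$ for all $i\in\mathcal{I}$, where $x^*(t)=\frac1n\sum_{i=1}^n x_i(t)$, and they minimize the team objective function as $t\to+\infty$, i.e., $\lim_{t\to+\infty}\|x_i(t)-P_{\mathcal{X}}(x^*(t))\|=0$ for all $i\in\mathcal{I}$, where $\mathcal{X}$ is the set of minimizers of $\sum_{i=1}^n f_i(s)$ over $s\in H$.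
   Context: Let $\mathcal{I}=\{1,\ldots,n\}$ index $n$ agents. For each $i\in\mathcal{I}$, $f_i:\mathbb{R}^r\to\mathbb{R}$ is a differentiable convex function and $H_i\subseteq\mathbb{R}^r$ is a closed convex set. $\|\cdot\|$ is the Euclidean norm, and for a nonempty closed convex set $K$, $P_K(s)=\arg\min_{\bar s\in K}\|s-\bar s\|$ is the Euclidean projection onto $K$. The optimization problem is: minimize $\sum_{i=1}^n f_i(s)$ subject to $s\in H=\bigcap_{i=1}^n H_i$ (equivalently, minimize $\sum_{i=1}^n f_i(x_i)$ subject to $x_i=x_j\in H$ for all $i,j$). Its optimal set is denoted $\mathcal{X}$; under hypotheses (i) and (ii) of the claim, $\mathcal{X}$ is known to be a nonempty closed bounded convex set. Graphs. For each time $t\ge 0$, $\mathcal{G}(t)$ is a directed weighted graph with node set $\mathcal{I}$, edge set $\mathcal{E}(t)\subseteq\mathcal{I}\times\mathcal{I}$ and weighted adjacency matrix $[a_{ij}(t)]\in\mathbb{R}^{n\times n}$. There are fixed constants $\bar\eta>\eta>0$ such that $\eta\le a_{ij}(t)\le\bar\eta$ if $(j,i)\in\mathcal{E}(t)$ and $a_{ij}(t)=0$ otherwise; $a_{ii}(t)=0$, i.e. $(i,i)\notin\mathcal{E}(t)$. The neighbor set of agent $i$ is $N_i(t)=\{j\in\mathcal{I}\mid (j,i)\in\mathcal{E}(t)\}$. The graph is balanced if $\sum_{j=1}^n a_{ij}(t)=\sum_{j=1}^n a_{ji}(t)$ for all $i$. It is strongly connected if there is a directed path from every agent to every other agent. The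 union of a family of graphs is the graph on $\mathcal{I}$ whose edge set is the union of their edge sets. The weighted graph $\mathcal{G}(t)$ is constant in $t$ between contiguous switching times (the initial time $0$ is counted as a switching time). Closed-loop system. The agents satisfy $\dot x_i(t)=u_i(t)$ with $x_i(t)\in\mathbb{R}^r$, and for all $i\in\mathcal{I}$ $$\dot q_i(t)=\arctan\big(e^{\|x_i(t)\|}\big),\quad q_i(0)>0,$$ $$u_i(t)=\sum_{j\in N_i(t)}a_{ij}(t)\big(x_j(t)-x_i(t)\big)-\big[x_i(t)-P_{H_i}(x_i(t))\big]-\frac{\nabla f_i(x_i(t))}{\sqrt{q_i(t)}}.$$ Trajectories are continuous and satisfy these differential equations except possibly at switching times. *)

(* Defs.v *)
From HB Require Import structures.
From mathcomp Require Import all_boot all_order all_algebra.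
From mathcomp Require Import all_classical all_reals all_analysis.

Set Implicit Arguments.
Unset Strict Implicit.
Unset Printing Implicit Defensive.

Import Order.TTheory GRing.Theory Num.Theory.
Import numFieldNormedType.Exports.

Local Open Scope classical_set_scope.
Local Open Scope ring_scope.

Section Euclidean.
Context {R : realType} {r : nat}.
Implicit Types (s x : 'rV[R]_r) (K : set 'rV[R]_r).

(* The library norm on 'rV[R]_r is the sup norm, whence this definition. The
   two induce the same topology and the same bounded sets, so the library's
   [closed], [bounded_set], [differentiable] and limits are used unchanged. *)
Definition euclid_norm x : R := Num.sqrt (\sum_j x 0 j ^+ 2).

(* The minimizer exists and is unique for nonempty closed convex K; otherwise
   [get] may return an arbitrary point. *)
Definition euclid_proj K s : 'rV[R]_r :=
  get [set z | K z /\ forall y, K y ->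
        euclid_norm (s - z) <= euclid_norm (s - y)].

Definition gradient (f : 'rV[R]_r -> R) x : 'rV[R]_r :=
  \row_j 'D_(delta_mx 0 j) f x.

Definition critical_points (f : 'rV[R]_r -> R) : set 'rV[R]_r :=
  [set x | gradient f x = 0].

Definition minimizers K (F : 'rV[R]_r -> R) : set 'rV[R]_r :=
  [set s | K s /\ forall y, K y -> F s <= F y].

End Euclidean.

(* An edge (j, i) means that agent i receives information from agent j, and
   its weight is a_ij, i.e. the entry [weight g i j]. *)
Record wdigraph (R : realType) (n : nat) := WDigraph {
  edges : {set 'I_n * 'I_n};
  weight : 'M[R]_n
}.

Section Graphs.
Context {R : realType} {n : nat}.
Implicit Types (g : wdigraph R n) (G : R -> wdigraph R n).

Definition neighbors g (i : 'I_n) : {set 'I_n} := [set j | (j, i) \in edges g].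

Definition admissible (eta etabar : R) g : Prop :=
  (forall i, (i, i) \notin edges g) /\
  forall i j, ((j, i) \in edges g -> eta <= weight g i j <= etabar) /\
              ((j, i) \notin edges g -> weight g i j = 0).

Definition balanced g : Prop :=
  forall i, \sum_j weight g i j = \sum_j weight g j i.

Definition strongly_connected (E : {set 'I_n * 'I_n}) : Prop :=
  forall i j, connect [rel u v | (u, v) \in E] i j.

Definition union_edges G (T : set R) : {set 'I_n * 'I_n} :=
  [set e | `[< exists2 t, T t & e \in edges (G t) >]].

(* tau enumerates the switching times in increasing order, starting with the
   initial time 0. The graph is constant on the half-open [tau k, tau k.+1):
   its value at a switching time is the one that holds just afterwards. *)
Definition switching_times G (tau : nat -> R) : Prop :=
  [/\ tau 0%N = 0,
      (forall k, tau k < tau k.+1) &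
      (forall k (t : R), tau k <= t < tau k.+1 -> G t = G (tau k))].

End Graphs.

Section ClosedLoop.
Context {R : realType} {n r : nat}.
Variables (f : 'I_n -> 'rV[R]_r -> R) (H : 'I_n -> set 'rV[R]_r).
Variables (G : R -> wdigraph R n) (tau : nat -> R).
Variables (x : 'I_n -> R -> 'rV[R]_r) (q : 'I_n -> R -> R).

Definition control (i : 'I_n) (t : R) : 'rV[R]_r :=
  \sum_(j in neighbors (G t) i) weight (G t) i j *: (x j t - x i t)
  - (x i t - euclid_proj (H i) (x i t))
  - (Num.sqrt (q i t))^-1 *: gradient (f i) (x i t).

(* Only values at times t >= 0 matter; the differential equations may fail at
   the switching times, 0 included. *)
Definition closed_loop_trajectory : Prop :=
  forall i,
  [/\ {within `[0, +oo[, continuous (x i)},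
      {within `[0, +oo[, continuous (q i)},
      0 < q i 0,
      (forall t : R, 0 <= t -> (forall k, t != tau k) ->
         is_derive t 1 (x i) (control i t)) &
      (forall t : R, 0 <= t -> (forall k, t != tau k) ->
         is_derive t 1 (q i) (atan (expR (euclid_norm (x i t)))))].

Definition average (t : R) : 'rV[R]_r := n%:R^-1 *: \sum_i x i t.

End ClosedLoop.

(* Main.v *)
Require Import Defs.
From HB Require Import structures.
From mathcomp Require Import all_boot all_order all_algebra.
From mathcomp Require Import all_classical all_reals all_analysis.
From mathcomp Require Import ring lra.

Set Implicit Arguments.
Unset Strict Implicit.
Unset Printing Implicit Defensive.

Import Order.TTheory GRing.Theory Num.Theory.
Import numFieldNormedType.Exports.

Local Open Scope classical_set_scope.
Local Open Scope ring_scope.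

(** The state is viewed as a consensus dynamics that is constrained by the sets
    H i and perturbed by the gradient terms. The gains 1 / sqrt (q i) tend to 0, so
    these terms are eventually negligible for consensus and feasibility; yet they
    decay only like 1 / sqrt t, which is not integrable, so their effect on the
    position along the intersection of the H i never dies out.

    The Lyapunov function is V z = sum_i |x i - z|^2 for a fixed point z common to
    all H i. Balance turns the coupling into minus the sum of the
    a_ij |x i - x j|^2 (balanced_dissipation), the projection terms contribute
    minus twice the sum of the |x i - P_(H i) (x i)|^2 (proj_residual_dot), and
    convexity bounds the gradient term by the excess values f i (x i) - f i z.
    Each f i is coercive because its critical set is nonempty and bounded
    (convex_coercive). Hence V z cannot increase while some agent is far away,
    and the trajectories are bounded (trajectories_bounded).

    Consensus and feasibility (perturbed_consensus). If V z hardly drops over a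
    window [ts j, ts j+1], the dissipation is small at some time of each piece
    between switchings, and the agents hardly move; as every edge of the
    connected union is active on a whole piece, all agents nearly agree and nearly
    satisfy their constraints at the start of the window. By compactness they are
    then close to the intersection. So as long as V z, for z the projection of the
    average, is not small, it loses a fixed amount per window, and it tends to 0.

    Optimality (optimal_deviation_vanish). The rate of q i depends only on the
    position of agent i, so consensus makes the gains asymptotically proportional
    (gain_ratio_agree), and the weighted sum of the excess values becomes a
    multiple of the excess of the total objective at the average. Away from the
    optimal set this excess is bounded below (excess_away_from_minimizers). Taking
    for z the optimum closest to the average at an integer time k, V z loses at
    least a constant over sqrt (k + 2) on [k, k + 1]; these losses have a divergent
    sum, so the squared deviation from the optimal set tends to 0.

    Derivatives exist only between switching times. The mean value theorem is
    applied on each piece, and no integral is needed: a bound on the speed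
    of an agent by the dissipation becomes a bound on its displacement by the drop
    of V z (piecewise_displacement). *)

Local Notation "⟦ x ⟧" := (euclid_norm x) (at level 0, format "⟦ x ⟧").

(** * Euclidean geometry of row vectors *)

Lemma sum_ord_const (R : realType) n (c : R) : \sum_(i < n) c = n%:R * c.
Proof. by rewrite sumr_const card_ord mulr_natl. Qed.

Section EuclideanGeometry.
Context {R : realType} {r : nat}.
Implicit Types (u v w : 'rV[R]_r) (K : set 'rV[R]_r).

Definition dot u v : R := \sum_j u 0 j * v 0 j.

Lemma dotC u v : dot u v = dot v u.
Proof. by apply: eq_bigr => j _; rewrite mulrC. Qed.

Lemma dotDr u v w : dot u (v + w) = dot u v + dot u w.
Proof. by rewrite -big_split; apply: eq_bigr => j _; rewrite mxE mulrDr. Qed.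

Lemma dotDl u v w : dot (v + w) u = dot v u + dot w u.
Proof. by rewrite dotC dotDr !(dotC u). Qed.

Lemma dotZr a u v : dot u (a *: v) = a * dot u v.
Proof. by rewrite mulr_sumr; apply: eq_bigr => j _; rewrite mxE mulrCA. Qed.

Lemma dotZl a u v : dot (a *: u) v = a * dot u v.
Proof. by rewrite dotC dotZr dotC. Qed.

Lemma dotNr u v : dot u (- v) = - dot u v.
Proof. by rewrite -scaleN1r dotZr mulN1r. Qed.

Lemma dotNl u v : dot (- u) v = - dot u v.
Proof. by rewrite dotC dotNr dotC. Qed.

Lemma dotBr u v w : dot u (v - w) = dot u v - dot u w.
Proof. by rewrite dotDr dotNr. Qed.

Lemma dotBl u v w : dot (v - w) u = dot v u - dot w u.
Proof. by rewrite dotDl dotNl. Qed.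

Lemma dot0r u : dot u 0 = 0.
Proof. by rewrite -(scale0r 0) dotZr mul0r. Qed.

Lemma dot0l u : dot 0 u = 0.
Proof. by rewrite dotC dot0r. Qed.

Lemma dot_sumr (I : finType) (P : pred I) (F : I -> 'rV[R]_r) u :
  dot u (\sum_(i | P i) F i) = \sum_(i | P i) dot u (F i).
Proof. by apply: big_morph; [exact: dotDr | exact: dot0r]. Qed.

Lemma dot_suml (I : finType) (P : pred I) (F : I -> 'rV[R]_r) u :
  dot (\sum_(i | P i) F i) u = \sum_(i | P i) dot (F i) u.
Proof. by rewrite dotC dot_sumr; apply: eq_bigr => i _; rewrite dotC. Qed.

Lemma dot_ge0 u : 0 <= dot u u.
Proof. by apply: sumr_ge0 => j _; rewrite -expr2 sqr_ge0. Qed.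

Lemma dot_eq0 u : dot u u = 0 -> u = 0.
Proof.
move=> u0; apply/rowP => j; rewrite mxE; apply/eqP; rewrite -sqrf_eq0 expr2.
by apply/eqP/(psumr_eq0P _ u0) => // i _; rewrite -expr2 sqr_ge0.
Qed.

Lemma norm_ge0 u : 0 <= ⟦u⟧.
Proof. exact: sqrtr_ge0. Qed.

Lemma sqr_norm u : ⟦u⟧ ^+ 2 = dot u u.
Proof.
rewrite sqr_sqrtr; first by apply: eq_bigr => j _; rewrite expr2.
by apply: sumr_ge0 => j _; rewrite sqr_ge0.
Qed.

Lemma norm_eq0 u : ⟦u⟧ = 0 -> u = 0.
Proof. by move=> u0; apply: dot_eq0; rewrite -sqr_norm u0 expr0n. Qed.

Lemma norm_scale a u : ⟦a *: u⟧ = `|a| * ⟦u⟧.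
Proof.
apply/eqP; rewrite -(eqrXn2 (n := 2)) ?mulr_ge0 ?norm_ge0//.
by rewrite exprMn !sqr_norm dotZl dotZr mulrA -expr2 real_normK ?num_real.
Qed.

Lemma norm_opp u : ⟦- u⟧ = ⟦u⟧.
Proof. by rewrite -scaleN1r norm_scale normrN1 mul1r. Qed.

Lemma norm_distC u v : ⟦u - v⟧ = ⟦v - u⟧.
Proof. by rewrite -norm_opp opprB. Qed.

Lemma norm_zero : ⟦0 : 'rV[R]_r⟧ = 0.
Proof. by rewrite -(scale0r 0) norm_scale normr0 mul0r. Qed.

Lemma dot_le_norm u v : dot u v <= ⟦u⟧ * ⟦v⟧.
Proof.
have [u0|/eqP u0] := eqVneq ⟦u⟧ 0.
  by rewrite u0 (norm_eq0 u0) dot0l mul0r.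
have [v0|/eqP v0] := eqVneq ⟦v⟧ 0.
  by rewrite v0 (norm_eq0 v0) dot0r mulr0.
have uv_gt0 : 0 < ⟦u⟧ * ⟦v⟧.
  by rewrite mulr_gt0// lt0r norm_ge0 andbT; apply/eqP.
have := dot_ge0 (⟦v⟧ *: u - ⟦u⟧ *: v).
rewrite dotBl !dotBr !dotZl !dotZr -!sqr_norm (dotC v u) => h.
rewrite -subr_ge0 -(pmulr_rge0 _ uv_gt0).
by nra.
Qed.

Lemma norm_triangle u v : ⟦u + v⟧ <= ⟦u⟧ + ⟦v⟧.
Proof.
rewrite -(ler_pXn2r (n := 2)) ?nnegrE ?addr_ge0 ?norm_ge0//.
rewrite sqr_norm dotDl !dotDr (dotC v u) -!sqr_norm.
have := dot_le_norm u v; nra.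
Qed.

Lemma dist_triangle w u v : ⟦u - v⟧ <= ⟦u - w⟧ + ⟦w - v⟧.
Proof. by rewrite -[u - v](subrKA w) norm_triangle. Qed.

Lemma norm_sum (I : finType) (P : pred I) (F : I -> 'rV[R]_r) :
  ⟦\sum_(i | P i) F i⟧ <= \sum_(i | P i) ⟦F i⟧.
Proof.
elim/big_rec2: _ => [|i y x _ le_xy]; first by rewrite norm_zero.
by apply: le_trans (norm_triangle _ _) _; rewrite lerD2l.
Qed.

Lemma coord_le_norm u j : `|u 0 j| <= ⟦u⟧.
Proof.
rewrite -(ler_pXn2r (n := 2)) ?nnegrE ?norm_ge0// sqr_norm real_normK ?num_real//.
by rewrite /dot (bigD1 j)//= -expr2 lerDl sumr_ge0// => i _; rewrite -expr2 sqr_ge0.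
Qed.

Lemma supnorm_le_norm u : `|u| <= ⟦u⟧.
Proof.
rewrite [leLHS]/Num.Def.normr/= mx_normrE bigmax_le ?norm_ge0//= => -[i j] _.
by rewrite (ord1 i) coord_le_norm.
Qed.

Lemma norm_le_supnorm u : ⟦u⟧ <= r%:R * `|u|.
Proof.
rewrite [in leLHS](row_sum_delta u); apply: le_trans (norm_sum _ _) _.
rewrite -sum_ord_const.
apply: ler_sum => j _; rewrite norm_scale.
have -> : ⟦delta_mx 0 j : 'rV[R]_r⟧ = 1.
  rewrite /euclid_norm (bigD1 j)//= big1 ?addr0; last first.
    by move=> i ij; rewrite mxE (negbTE ij) andbF expr0n.
  by rewrite mxE !eqxx /= expr1n sqrtr1.
rewrite mulr1 [leRHS]/Num.Def.normr/= mx_normrE.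
exact: (le_bigmax _ (fun ij => `|u ij.1 ij.2|) (0, j)).
Qed.

Lemma sum_cvg (T : Type) (F : set_system T) (I : finType) (g : I -> T -> R) (l : I -> R) :
  Filter F -> (forall i, g i @ F --> l i) ->
  \sum_i g i t @[t --> F] --> \sum_i l i.
Proof. by move=> FF gl; apply: cvg_big => //; exact: add_continuous. Qed.

Lemma sum_continuous (T : topologicalType) (I : finType) (g : I -> T -> R) :
  (forall i, continuous (g i)) -> continuous (fun t => \sum_i g i t).
Proof. by move=> gc t; apply: sum_cvg => i; exact: gc. Qed.

Lemma dot_cvg (T : Type) (F : set_system T) (g h : T -> 'rV[R]_r) u v :
  Filter F -> g @ F --> u -> h @ F --> v -> dot (g t) (h t) @[t --> F] --> dot u v.
Proof.
move=> FF gu hv; apply: sum_cvg => j.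
by apply: cvgM; [apply: (cvg_comp _ _ gu (@coord_continuous R 1 r 0 j u)) |
  apply: (cvg_comp _ _ hv (@coord_continuous R 1 r 0 j v))].
Qed.

Lemma euclid_norm_cvg (T : Type) (F : set_system T) (g : T -> 'rV[R]_r) u :
  Filter F -> g @ F --> u -> ⟦g t⟧ @[t --> F] --> ⟦u⟧.
Proof.
move=> FF gu; have normE w : ⟦w⟧ = Num.sqrt (dot w w).
  by rewrite -sqr_norm sqrtr_sqr ger0_norm ?norm_ge0.
rewrite normE; under eq_fun do rewrite normE.
exact: (cvg_comp _ _ (dot_cvg FF gu gu) (@sqrt_continuous R (dot u u))).
Qed.

Lemma euclid_norm_continuous : continuous (@euclid_norm R r).
Proof. by move=> u; have := @euclid_norm_cvg _ (nbhs u) id u _ cvg_id; exact. Qed.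

Lemma euclid_dist_continuous s : continuous (fun u : 'rV[R]_r => ⟦s - u⟧).
Proof.
move=> u; have cs : {for u, continuous (fun=> s)} by exact: cst_continuous.
have cid : {for u, continuous (fun t => t)} by move=> ?; exact.
exact: (euclid_norm_cvg _ (continuousB cs cid)).
Qed.

Lemma euclid_ball_compact K (B : R) :
  closed K -> compact (K `&` [set u | ⟦u⟧ <= B]).
Proof.
move=> cK; apply: bounded_closed_compact.
  exists B; split; first exact: num_real.
  by move=> M /ltW BM u [_ /= uB]; apply: le_trans (supnorm_le_norm u) (le_trans uB BM).
apply: closedI => //; apply: (@preimage_closed _ _ (@euclid_norm R r) [set y | y <= B]) => //.
by move=> u _; exact: euclid_norm_continuous.
Qed.

End EuclideanGeometry.

(** * Compactness and projections *)

Section Compactness.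
Context {R : realType} {r : nat}.
Implicit Types (A K : set 'rV[R]_r) (phi : 'rV[R]_r -> R).

Lemma compact_lower_bound A phi : compact A -> continuous phi ->
  (forall u, A u -> 0 < phi u) ->
  exists2 delta, 0 < delta & forall u, A u -> delta <= phi u.
Proof.
move=> cA cphi phi_gt0.
have [A0|/set0P/negP] := pselect (A !=set0); last first.
  (* Any constant works on the empty set. *)
  by rewrite negbK => /eqP ->; exists 1.
have [c cA' phi_min] := EVT_min_rV A0 cA (continuous_subspaceT cphi).
exists (phi c); first by apply: phi_gt0; rewrite inE in cA'.
by move=> u Au; apply: phi_min; rewrite inE.
Qed.

Lemma compact_upper_bound A phi : compact A -> continuous phi ->
  exists M, forall u, A u -> phi u <= M.
Proof.
move=> cA cphi.
have [A0|/set0P/negP] := pselect (A !=set0); last first.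
  by rewrite negbK => /eqP ->; exists 0.
have [c _ phi_max] := EVT_max_rV A0 cA (continuous_subspaceT cphi).
by exists (phi c) => u Au; apply: phi_max; rewrite inE.
Qed.

(** Points beyond a large enough radius do worse than a given point y0 of K, so
    it suffices to minimize over a compact part of K. *)
Lemma coercive_has_minimizer K phi : closed K -> K !=set0 -> continuous phi ->
  (forall c, exists Rad, forall s, Rad <= ⟦s⟧ -> c <= phi s) ->
  exists s, minimizers K phi s.
Proof.
move=> cK [y0 Ky0] cphi phi_coer; have [Rad hRad] := phi_coer (phi y0).
have Ay0 : (K `&` [set u | ⟦u⟧ <= Num.max Rad ⟦y0⟧]) y0.
  by split => //=; rewrite le_max lexx orbT.
have [c cA phi_min] := EVT_min_rV (ex_intro _ _ Ay0)
  (euclid_ball_compact (B := Num.max Rad ⟦y0⟧) cK) (continuous_subspaceT cphi).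
rewrite inE in cA; exists c; split; first by case: cA.
move=> y Ky; have [yB|By] := leP ⟦y⟧ (Num.max Rad ⟦y0⟧).
  by apply: phi_min; rewrite inE.
apply: (@le_trans _ _ (phi y0)); first by apply: phi_min; rewrite inE.
by apply: hRad; rewrite (le_trans _ (ltW By))// le_max lexx.
Qed.

Lemma minimizers_closed K phi : closed K -> continuous phi ->
  closed (minimizers K phi).
Proof.
move=> cK cphi; have -> : minimizers K phi =
    K `&` \bigcap_(y in K) (phi @^-1` [set v | v <= phi y]).
  by apply/seteqP; split=> s [Ks smin]; split.
apply: closedI => //; apply: closed_bigI => y _.
by apply: preimage_closed => // u _; exact: cphi.
Qed.

End Compactness.

Section Projection.
Context {R : realType} {r : nat}.
Implicit Types (K X : set 'rV[R]_r) (s t y z : 'rV[R]_r).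

Lemma euclid_projP K s : closed K -> K !=set0 ->
  K (euclid_proj K s) /\ forall y, K y -> ⟦s - euclid_proj K s⟧ <= ⟦s - y⟧.
Proof.
move=> cK K0; apply: (@getPex _
  [set z | K z /\ forall y, K y -> ⟦s - z⟧ <= ⟦s - y⟧]).
apply: (@coercive_has_minimizer _ _ K (fun u => ⟦s - u⟧)) => //.
  exact: euclid_dist_continuous.
move=> c; exists (⟦s⟧ + c) => u.
have := dist_triangle s u 0; rewrite !subr0 norm_distC; lra.
Qed.

Lemma proj_in K s : closed K -> K !=set0 -> K (euclid_proj K s).
Proof. by move=> cK K0; have [] := euclid_projP s cK K0. Qed.

Lemma proj_min K s y : closed K -> K y -> ⟦s - euclid_proj K s⟧ <= ⟦s - y⟧.
Proof. by move=> cK Ky; apply: (euclid_projP s cK _).2 => //; exists y. Qed.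

Lemma dist_proj_lipschitz K s t : closed K -> K !=set0 ->
  ⟦s - euclid_proj K s⟧ <= ⟦s - t⟧ + ⟦t - euclid_proj K t⟧.
Proof.
by move=> cK K0; apply: le_trans (proj_min s cK (proj_in t cK K0)) (dist_triangle _ _ _).
Qed.

Lemma dist_proj_continuous K : closed K -> K !=set0 ->
  continuous (fun s => ⟦s - euclid_proj K s⟧).
Proof.
move=> cK K0 s.
apply/(@cvgrPdist_le _ _ _ (nbhs s) _) => e e0.
have := @euclid_dist_continuous _ _ s s.
rewrite /continuous_at subrr norm_zero => /(@cvgrPdist_le _ _ _ (nbhs s) _)/(_ e e0).
apply: filterS => t /=; rewrite sub0r normrN ger0_norm ?norm_ge0// => ste.
have h1 := dist_proj_lipschitz s t cK K0.
have := dist_proj_lipschitz t s cK K0; rewrite (norm_distC t s) => h2.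
by rewrite ler_norml; lra.
Qed.

Lemma convex_set_comb K s t (l : R) : convex_set K -> K s -> K t ->
  0 <= l -> l <= 1 -> K (l *: s + (1 - l) *: t).
Proof.
move=> cvK Ks Kt l0 l1.
by have := cvK s t (Itv01 l0 l1); rewrite !inE; exact.
Qed.

(** Moving from the projection towards y by a small amount must not come closer
    to s; the quadratic term is negligible at first order. *)
Lemma proj_variational K s y : closed K -> convex_set K -> K y ->
  dot (s - euclid_proj K s) (y - euclid_proj K s) <= 0.
Proof.
move=> cK cvK Ky; have Kp : K (euclid_proj K s) by apply: proj_in => //; exists y.
have pmin z : K z -> ⟦s - euclid_proj K s⟧ <= ⟦s - z⟧ by exact: proj_min.
move: (euclid_proj K s) Kp pmin => p Kp pmin.
rewrite leNgt; apply/negP; set d := dot _ _ => d0.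
set N := dot (y - p) (y - p); have N0 : 0 <= N by exact: dot_ge0.
(* With this step, l * N < d, so the linear gain exceeds the quadratic loss. *)
set l := d / (d + N); have dN0 : 0 < d + N by lra.
have l0 : 0 < l by rewrite divr_gt0.
have l1 : l <= 1 by rewrite ler_pdivrMr// mul1r lerDl.
have := pmin _ (convex_set_comb cvK Ky Kp (ltW l0) l1).
have -> : s - (l *: y + (1 - l) *: p) = (s - p) - l *: (y - p).
  by apply/rowP => j; rewrite !mxE; ring.
rewrite -(ler_pXn2r (n := 2)) ?nnegrE ?norm_ge0// !sqr_norm.
move: (s - p) (y - p) @d @N {l1} @l d0 N0 dN0 l0 => a b d N l d0 N0 dN0 l0.
rewrite dotBl !dotBr !dotZl !dotZr (dotC b a) -/d -/N => h.
have : 2 * d <= l * N by rewrite -(ler_pM2l l0); lra.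
rewrite /l mulrAC ler_pdivlMr//; nra.
Qed.

(** This is the inequality that makes each term x - P_K x of the dynamics push
    towards every point z of K. *)
Lemma proj_residual_dot K s z : closed K -> convex_set K -> K z ->
  ⟦s - euclid_proj K s⟧ ^+ 2 <= dot (s - z) (s - euclid_proj K s).
Proof.
move=> cK cvK Kz; have := proj_variational s cK cvK Kz.
set p := euclid_proj K s; rewrite sqr_norm.
have -> : s - z = (s - p) - (z - p) by rewrite opprB addrA subrK.
by rewrite (dotBl _ (s - p)) (dotC (z - p)); lra.
Qed.

Lemma dist_le0_in K s : closed K -> K !=set0 -> ⟦s - euclid_proj K s⟧ <= 0 -> K s.
Proof.
move=> cK K0 h; suff -> : s = euclid_proj K s by exact: proj_in.
by apply/eqP; rewrite -subr_eq0; apply/eqP/norm_eq0/le_anti; rewrite h norm_ge0.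
Qed.

(** The sum of the distances to the H i vanishes only on the intersection, hence
    is bounded below on the compact set of points that are far from it. There is
    no explicit modulus for general closed convex sets. *)
Lemma near_intersection (n : nat) (H : 'I_n -> set 'rV[R]_r) (B e : R) :
  (forall i, closed (H i)) -> \bigcap_i H i !=set0 -> 0 < e ->
  exists2 sigma, 0 < sigma & forall s, ⟦s⟧ <= B ->
    (forall i, ⟦s - euclid_proj (H i) s⟧ <= sigma) ->
    ⟦s - euclid_proj (\bigcap_i H i) s⟧ <= e.
Proof.
move=> cH [z Hz] e0.
have cI : closed (\bigcap_i H i) by apply: closed_bigI => i _.
have I0 : \bigcap_i H i !=set0 by exists z.
have Hi0 i : H i !=set0 by exists z; exact: Hz.
pose far := [set s | e <= ⟦s - euclid_proj (\bigcap_i H i) s⟧].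
have far_closed : closed far.
  apply: (@preimage_closed _ _ _ [set v | e <= v]); last exact: closed_ge.
  by move=> s _; exact: dist_proj_continuous.
have [|||d d0 hd] := @compact_lower_bound R r
    (far `&` [set s | ⟦s⟧ <= B]) (fun s => \sum_i ⟦s - euclid_proj (H i) s⟧).
- exact: euclid_ball_compact.
- by apply: sum_continuous => i; exact: dist_proj_continuous.
- move=> s [/= sfar _]; rewrite lt0r sumr_ge0 ?andbT; last by move=> i _; exact: norm_ge0.
  apply/negP => /eqP/psumr_eq0P s0.
  have Is : (\bigcap_i H i) s.
    move=> i _; apply: dist_le0_in => //; rewrite s0// => j _; exact: norm_ge0.
  by have := proj_min s cI Is; move: sfar; rewrite /far /= subrr norm_zero; lra.
(* n terms of at most d / (n + 1) add up to less than d, also when n = 0. *)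
exists (d / (n.+1)%:R); first by rewrite divr_gt0.
move=> s sB near; rewrite leNgt; apply/negP => sfar.
have := hd s (conj (ltW sfar) sB); apply/negP; rewrite -ltNge.
apply: (@le_lt_trans _ _ (\sum_(i < n) d / n.+1%:R)); first exact: ler_sum.
by rewrite sum_ord_const mulrC mulrAC ltr_pdivrMr// ltr_pM2l// ltr_nat.
Qed.

(** The maximum of the excess value and of the distance to K is positive off the
    minimizers, hence is bounded below on the compact set of points that are far
    from them; a small distance to K then leaves only the excess value. *)
Lemma excess_away_from_minimizers K phi z (B e : R) :
  closed K -> continuous phi -> minimizers K phi z -> 0 < e ->
  exists2 delta, 0 < delta & forall s, ⟦s⟧ <= B ->
    ⟦s - euclid_proj K s⟧ < delta ->
    e <= ⟦s - euclid_proj (minimizers K phi) s⟧ -> phi z + delta <= phi s.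
Proof.
move=> cK cphi zmin e0; have K0 : K !=set0 by exists z; case: zmin.
have cX := minimizers_closed cK cphi; have X0 : minimizers K phi !=set0 by exists z.
pose far := [set s | e <= ⟦s - euclid_proj (minimizers K phi) s⟧].
have far_closed : closed far.
  apply: (@preimage_closed _ _ _ [set v | e <= v]); last exact: closed_ge.
  by move=> s _; exact: dist_proj_continuous.
have [|||d d0 hd] := @compact_lower_bound R r (far `&` [set s | ⟦s⟧ <= B])
    (fun s => Num.max (phi s - phi z) ⟦s - euclid_proj K s⟧).
- exact: euclid_ball_compact.
- have cdiff : continuous (fun s => phi s - phi z).
    by move=> s; apply: continuousB; [exact: cphi | exact: cst_continuous].
  by move=> s; exact: (continuous_max (cdiff s) (dist_proj_continuous cK K0 (x := s))).
- move=> s [/= sfar _]; rewrite ltNge ge_max; apply/negP => /andP[le_phi dist0].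
  have Ks : K s by exact: dist_le0_in dist0.
  have Xs : minimizers K phi s.
    by split => // y Ky; case: zmin => _ /(_ y Ky); lra.
  by have := proj_min s cX Xs; move: sfar; rewrite /far /= subrr norm_zero; lra.
exists d => // s sB near sfar.
by have := hd s (conj sfar sB); rewrite le_max (leNgt d ⟦_⟧) near orbF; lra.
Qed.

End Projection.

(** * Differentiable convex functions *)

Section ConvexFunctions.
Context {R : realType} {r : nat}.
Variable f : 'rV[R]_r -> R.
Hypothesis f_diff : forall s, differentiable f s.
Hypothesis f_convex : convex_function setT f.
Implicit Types s u v y : 'rV[R]_r.

Lemma diff_fun_continuous : continuous f.
Proof. by move=> s; exact: differentiable_continuous. Qed.

Lemma convex_function_comb s u (l : R) : 0 <= l -> l <= 1 ->
  f (l *: s + (1 - l) *: u) <= l * f s + (1 - l) * f u.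
Proof.
by move=> l0 l1; apply: (@f_convex (Itv01 l0 l1) s u); rewrite inE.
Qed.

Lemma derive_gradient s v : 'D_v f s = dot (gradient f s) v.
Proof.
rewrite deriveE// [in LHS](row_sum_delta v) linear_sum.
by apply: eq_bigr => j _; rewrite linearZ /= -deriveE// mxE mulrC.
Qed.

Lemma derive_at_right s v :
  (fun h => h^-1 *: (f (h *: v + s) - f s)) @ 0^'+ --> dot (gradient f s) v.
Proof.
have fD : (fun h => h^-1 *: (f (h *: v + s) - f s)) @ 0^' --> 'D_v f s.
  exact: (@diff_derivable _ _ _ _ s v (f_diff s)).
by rewrite -derive_gradient; exact: (cvg_dnbhs_at_right fD).
Qed.

(** The difference quotient towards y at step h is at most f y - f s for every h
    in ]0, 1]; the derivative is its limit. *)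
Lemma convex_above_tangent s y : f s + dot (gradient f s) (y - s) <= f y.
Proof.
rewrite -lerBrDl; apply: (cvgr_to_le (@derive_at_right s (y - s))).
have lt01 : 0 < 1 :> R by [].
near=> h; have h0 : 0 < h by near: h; exact: nbhs_right_gt.
have h1 : h <= 1 by near: h; exact: nbhs_right_ltW.
rewrite /GRing.scale /= ler_pdivrMl//.
have -> : h *: (y - s) + s = h *: y + (1 - h) *: s.
  by apply/rowP => j; rewrite !mxE; ring.
have := convex_function_comb y s (ltW h0) h1; lra.
Unshelve. all: by end_near. Qed.

Lemma critical_point_min c y : critical_points f c -> f c <= f y.
Proof.
by move=> fc; have := convex_above_tangent c y; rewrite fc dot0l addr0.
Qed.

Lemma global_min_critical c : (forall y, f c <= f y) -> critical_points f c.
Proof.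
move=> cmin; have grad_ge0 v : 0 <= dot (gradient f c) v.
  apply: (cvgr_to_ge (@derive_at_right c v)); near=> h.
  have h0 : 0 < h by near: h; exact: nbhs_right_gt.
  by rewrite mulr_ge0 ?invr_ge0 ?(ltW h0)// subr_ge0.
apply: dot_eq0; apply: le_anti; rewrite dot_ge0 andbT.
by rewrite -oppr_ge0 -dotNr.
Unshelve. all: by end_near. Qed.

(** Outside a sphere enclosing the set of critical points the function exceeds
    its minimum by a fixed amount, by compactness of the sphere; convexity then
    propagates this gap linearly along rays. *)
Lemma convex_coercive : critical_points f !=set0 -> bounded_set (critical_points f) ->
  forall c, exists Rad, forall s, Rad <= ⟦s⟧ -> c <= f s.
Proof.
move=> [m fm] [rho0 [_ /(_ (Num.max rho0 0 + 1))]] bnd c.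
have rho0_lt : rho0 < Num.max rho0 0 + 1.
  by rewrite (@le_lt_trans _ _ (Num.max rho0 0)) ?ltrDl// le_max lexx.
have rho_ge0 : 0 <= Num.max rho0 0 by rewrite le_max lexx orbT.
have {bnd rho0_lt} := bnd rho0_lt; move: (Num.max rho0 0 + 1) (ltr_wpDl rho_ge0 ltr01).
move=> {rho0 rho_ge0} rho rho0 bnd.
(* The factor r converts the bound rho on the sup norm of critical points. *)
pose a := ⟦m⟧ + r%:R * rho + 1; have a0 : 0 < a.
  have := norm_ge0 m; have := mulr_ge0 (ler0n R r) (ltW rho0); rewrite /a; lra.
have sphere_closed : closed [set u | a <= ⟦m - u⟧].
  apply: (@preimage_closed _ _ _ [set v | a <= v]); last exact: closed_ge.
  by move=> s _; exact: euclid_dist_continuous.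
have [||| d d0 hd] := @compact_lower_bound R r
    ([set u | a <= ⟦m - u⟧] `&` [set u | ⟦u⟧ <= ⟦m⟧ + a]) (fun u => f u - f m).
- exact: euclid_ball_compact.
- by move=> u; apply: continuousB; [exact: diff_fun_continuous | exact: cst_continuous].
- move=> u [/= am _]; rewrite subr_gt0 lt_neqAle critical_point_min// andbT.
  apply/eqP => fmu; have fu : critical_points f u.
    by apply: global_min_critical => y; rewrite -fmu critical_point_min.
  have := norm_le_supnorm u; have := bnd _ fu => /= h1 h2.
  have h3 : r%:R * `|u| <= r%:R * rho by rewrite ler_wpM2l.
  have := dist_triangle 0 m u; rewrite subr0 sub0r norm_opp; move: am; rewrite /a; lra.
(* The gap grows at least like d * L / a at distance L from m. *)
exists (⟦m⟧ + a + `|c - f m| * a / d) => s hs.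
have t0 : 0 <= `|c - f m| * a / d by rewrite divr_ge0 ?(ltW d0)// mulr_ge0 ?(ltW a0).
set L := ⟦s - m⟧.
have aL : a + `|c - f m| * a / d <= L.
  by rewrite /L; have := dist_triangle m s 0; rewrite !subr0; lra.
have L0 : 0 < L by lra.
(* u below is the point at distance a from m on the segment from m to s. *)
have l0 : 0 < a / L by rewrite divr_gt0.
have l1 : a / L <= 1 by rewrite ler_pdivrMr//; lra.
have := convex_function_comb s m (ltW l0) l1.
set u := _ + _; have um : u - m = (a / L) *: (s - m).
  by apply/rowP => j; rewrite /u !mxE; ring.
have umn : ⟦u - m⟧ = a.
  by rewrite um norm_scale ger0_norm ?(ltW l0)// -/L mulfVK// gt_eqF.
have uB : ([set u | a <= ⟦m - u⟧] `&` [set u | ⟦u⟧ <= ⟦m⟧ + a]) u.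
  split => /=; first by rewrite norm_distC umn.
  by have := dist_triangle m u 0; rewrite !subr0 umn; lra.
have /= h1 := hd u uB; move=> h2; have h3 : d <= a / L * (f s - f m) by lra.
have h4 : d * L <= a * (f s - f m).
  by move: h3; rewrite mulrAC ler_pdivlMr.
have h5 : d * (a + `|c - f m| * a / d) = d * a + `|c - f m| * a.
  by field; rewrite gt_eqF.
have h6 : d * (a + `|c - f m| * a / d) <= d * L by rewrite ler_pM2l.
have h7 : a * `|c - f m| <= a * (f s - f m) by have := mulr_gt0 d0 a0; lra.
move: h7; rewrite ler_pM2l// => h7; have := ler_norm (c - f m); lra.
Qed.

(** The increment of f in the direction of its own gradient, over a unit step,
    dominates the norm of the gradient. *)
Lemma gradient_bounded (B : R) :
  exists2 L, 0 < L & forall s, ⟦s⟧ <= B -> ⟦gradient f s⟧ <= L.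
Proof.
have clT : closed (setT : set 'rV[R]_r) by exact: closedT.
have [M hM] := compact_upper_bound (euclid_ball_compact (B := B + 1) clT) diff_fun_continuous.
have cN : continuous (fun u => - f u).
  by move=> u; apply: continuousN; exact: diff_fun_continuous.
have [m hm] := compact_upper_bound (euclid_ball_compact (B := B) clT) cN.
exists (`|M + m| + 1); first by rewrite ltr_wpDl.
move=> s sB; set g := gradient f s; have [g0|g0] := eqVneq ⟦g⟧ 0.
  by rewrite g0 addr_ge0.
have e1 : ⟦⟦g⟧^-1 *: g⟧ = 1.
  by rewrite norm_scale ger0_norm ?invr_ge0 ?norm_ge0// mulVf.
have := convex_above_tangent s (s + ⟦g⟧^-1 *: g).
rewrite [s + _]addrC addrK dotZr -/g -sqr_norm expr2 mulrA mulVf// mul1r.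
have h1 : f (⟦g⟧^-1 *: g + s) <= M.
  by apply: hM; split => //=; apply: le_trans (norm_triangle _ _) _; rewrite e1; lra.
have /= h2 := hm s (conj I sB).
by have := ler_norm (M + m); lra.
Qed.

Lemma convex_lipschitz (B : R) : exists2 L, 0 < L & forall s y,
  ⟦s⟧ <= B -> ⟦y⟧ <= B -> f s - f y <= L * ⟦s - y⟧.
Proof.
have [L L0 hL] := gradient_bounded B; exists L => // s y sB yB.
have := convex_above_tangent s y.
have := dot_le_norm (gradient f s) (s - y); rewrite -[y - s]opprB dotNr => h1 h2.
have : ⟦gradient f s⟧ * ⟦s - y⟧ <= L * ⟦s - y⟧.
  by rewrite ler_wpM2r ?norm_ge0 ?hL.
lra.
Qed.

End ConvexFunctions.

(** * Calculus between switching times *)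

Section PiecewiseCalculus.
Context {R : realType}.
Variables (tau : nat -> R) (d_w : R).
Hypothesis tau0 : tau 0%N = 0.
Hypothesis d_w_gt0 : 0 < d_w.
Hypothesis dwell : forall k, d_w <= tau k.+1 - tau k.

Definition off_switch (t : R) := forall k, t != tau k.

Lemma tau_lt k l : (k < l)%N -> tau k + d_w <= tau l.
Proof.
elim: l => // l IH; rewrite ltnS leq_eqVlt => /predU1P[->|/IH kl].
  by have := dwell l; lra.
by have := dwell l; have := d_w_gt0; lra.
Qed.

Lemma tau_le k l : (k <= l)%N -> tau k <= tau l.
Proof.
by rewrite leq_eqVlt => /predU1P[->//|/tau_lt]; have := d_w_gt0; lra.
Qed.

Lemma tau_ge0 k : 0 <= tau k.
Proof. by rewrite -tau0 tau_le. Qed.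

Lemma tau_unbounded (b : R) : exists k, b <= tau k.
Proof.
have lin k : k%:R * d_w <= tau k.
  elim: k => [|k IH]; first by rewrite mul0r tau0.
  by have := dwell k; rewrite -natr1 mulrDl mul1r; lra.
exists (Num.trunc (`|b| / d_w)).+1; apply: le_trans (lin _).
rewrite -ler_pdivrMr//; apply: (@le_trans _ _ (`|b| / d_w)).
  by rewrite ler_pM2r ?invr_gt0// ler_norm.
exact/ltW/truncnS_gt.
Qed.

Lemma tau_le_of_lt k l : tau k < tau l.+1 -> (k <= l)%N.
Proof.
by move=> h; rewrite leqNgt; apply/negP => /tau_le; lra.
Qed.

Lemma tau_piece (t : R) : 0 <= t -> exists k, tau k <= t < tau k.+1.
Proof.
move=> t0; have [k hk] := tau_unbounded (t + 1).
have : t < tau k by lra.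
elim: k {hk} => [|k IH] h; first by move: h; rewrite tau0; lra.
have [tk|kt] := ltP t (tau k); first exact: IH.
by exists k; rewrite kt h.
Qed.

Lemma off_switch_inside k (t : R) : tau k < t < tau k.+1 -> off_switch t.
Proof.
move=> /andP[kt tk] l; apply/eqP => tl; move: kt tk; rewrite tl => kt tk.
have := tau_le_of_lt tk; rewrite leqNgt; apply/negP.
by rewrite negbK ltnNge; apply/negP => /tau_le; lra.
Qed.

(** The bound is obtained piece by piece, since no derivative is available at
    the switching times. *)
Lemma piecewise_increment (phi : R -> R) (a b C : R) :
  {within `[0, +oo[, continuous phi} -> 0 <= a -> a <= b ->
  (forall t, a < t < b -> off_switch t ->
     exists2 d, is_derive t 1 phi d & d <= C) ->
  phi b - phi a <= C * (b - a).
Proof.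
move=> cphi a0 ab hd; have [k bk] := tau_unbounded b.
elim: k b bk ab hd => [|k IH] b bk ab hd.
  have -> : b = a by apply: le_anti; rewrite ab andbT (le_trans bk)// tau0.
  by rewrite !subrr mulr0.
have piece c : a <= c -> tau k <= c -> c <= b -> phi b - phi c <= C * (b - c).
  move=> ac kc cb; have hdc t : t \in `]c, b[ -> is_derive t 1 phi ('D_1 phi t) /\ 'D_1 phi t <= C.
    rewrite in_itv /= => /andP[ct tb].
    have tk : tau k < t < tau k.+1 by apply/andP; split; lra.
    have tab : a < t < b by apply/andP; split; lra.
    have [d dd dC] := hd t tab (off_switch_inside tk).
    by rewrite derive_val; split.
  have cphi' : {within `[c, b], continuous phi}.
    by apply: continuous_subspaceW cphi; apply: subset_itv; rewrite bnd_simp// (le_trans a0).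
  move: cb; rewrite le_eqVlt => /predU1P[->|cb]; first by rewrite !subrr mulr0.
  have [t tcb ->] := MVT cb (fun t h => (hdc t h).1) cphi'.
  by rewrite ler_wpM2r ?subr_ge0 ?(ltW cb)// (hdc t tcb).2.
have [ka|ak] := leP (tau k) a; first exact: piece.
have [kb|bk'] := leP (tau k) b; last exact: IH (ltW bk') ab hd.
have h1 : phi (tau k) - phi a <= C * (tau k - a).
  apply: IH => //; first exact: ltW.
  by move=> t /andP[t1 t2]; apply: hd; rewrite t1 (lt_le_trans t2).
have := piece (tau k) (ltW ak) (lexx _) kb; lra.
Qed.

Lemma piecewise_increment_ge (phi : R -> R) (a b C : R) :
  {within `[0, +oo[, continuous phi} -> 0 <= a -> a <= b ->
  (forall t, a < t < b -> off_switch t ->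
     exists2 d, is_derive t 1 phi d & C <= d) ->
  C * (b - a) <= phi b - phi a.
Proof.
move=> cphi a0 ab hd; rewrite -lerN2 -mulNr opprB addrC -[X in _ + X <= _]opprK.
have cN : {within `[0, +oo[, continuous (fun t => - phi t)}.
  by move=> t; apply: cvgN; exact: cphi.
rewrite -[phi a]opprK addrC.
have := @piecewise_increment (fun t => - phi t) a b (- C) cN a0 ab.
rewrite /= mulNr => h; have {}h : - phi b - - phi a <= - (C * (b - a)).
  apply: h => t tab toff; have [d dd dC] := hd t tab toff.
  by exists (- d); [exact: is_deriveN | rewrite lerN2].
lra.
Qed.

(** A function that cannot increase while above the level L never crosses it:
    consider the last time at which it is at most L. *)
Lemma piecewise_barrier (phi : R -> R) (L : R) :
  {within `[0, +oo[, continuous phi} -> phi 0 <= L ->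
  (forall t, 0 < t -> off_switch t ->
     exists2 d, is_derive t 1 phi d & L < phi t -> d <= 0) ->
  forall t, 0 <= t -> phi t <= L.
Proof.
move=> cphi phi0 hd b b0; rewrite leNgt; apply/negP => Lb.
pose S := [set s : R | 0 <= s <= b /\ phi s <= L].
have S0 : S 0 by split => //; rewrite lexx.
have ubS : ubound S b by move=> s [/andP[]].
have supS : has_sup S by split; [exists 0 | exists b].
have c0 : 0 <= sup S by apply: sup_upper_bound.
have cb : sup S <= b by apply: ge_sup => //; exists 0.
have phic : phi (sup S) <= L.
  rewrite leNgt; apply/negP => Lc.
  have cA : (`[0, +oo[%classic : set R) (sup S) by rewrite /= in_itv /= c0.
  have /(_ _ cA)/cvgrPdist_lt/(_ (phi (sup S) - L)) := (subspace_continuousP _ _).1 cphi.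
  rewrite subr_gt0 => /(_ Lc); rewrite near_withinE => /nbhs_ballP[e /= e0 he].
  have [s [/andP[s0 sb] sL] se] := sup_adherent e0 supS.
  have sc : s <= sup S by apply: sup_upper_bound => //; split => //; rewrite s0.
  have /he : ball (sup S) e s.
    by rewrite /ball /= ltr_norml; apply/andP; split; lra.
  by rewrite /= in_itv /= s0 => /(_ isT); rewrite /from_subspace ltr_norml => /andP[]; lra.
have := piecewise_increment (C := 0) cphi c0 cb; rewrite mul0r.
suff hlt : forall t, sup S < t < b -> off_switch t ->
    exists2 d, is_derive t 1 phi d & d <= 0 by move=> /(_ hlt); lra.
move=> t /andP[ct tb] toff; have [d dd dle] := hd t (le_lt_trans c0 ct) toff.
exists d => //; apply: dle; rewrite ltNge; apply/negP => phit.
suff : t <= sup S by lra.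
by apply: sup_upper_bound => //; split => //; apply/andP; split; lra.
Qed.

End PiecewiseCalculus.

Section VectorCalculus.
Context {R : realType} {r : nat}.
Implicit Types (X : R -> 'rV[R]_r) (e z dX : 'rV[R]_r).

Lemma is_derive_coord X (t : R) dX j :
  is_derive t 1 X dX -> is_derive t 1 (fun t => X t 0 j) (dX 0 j).
Proof.
move=> [Xd Xv]; have Xdj := (derivable_mxP X t 1).1 Xd 0 j.
by apply: DeriveDef => //; rewrite -Xv derive_mx// mxE.
Qed.

Lemma is_derive_fsum (I : finType) (F : I -> R -> R) (dF : I -> R) (t : R) :
  (forall i, is_derive t 1 (F i) (dF i)) ->
  is_derive t 1 (fun t => \sum_i F i t) (\sum_i dF i).
Proof.
move=> FdF; rewrite (_ : (fun t => _) = \sum_i F i); last first.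
  by apply/funext => s; rewrite fct_sumE.
elim/big_rec2: _ => [|i df g _ IH]; first exact: is_derive_cst.
exact: is_deriveD.
Qed.

Lemma is_derive_dot e X (t : R) dX :
  is_derive t 1 X dX -> is_derive t 1 (fun t => dot e (X t)) (dot e dX).
Proof.
move=> /is_derive_coord XdX; apply: is_derive_fsum => j.
Qed.

Lemma is_derive_sqr_dist z X (t : R) dX : is_derive t 1 X dX ->
  is_derive t 1 (fun t => ⟦X t - z⟧ ^+ 2) (2 * dot (X t - z) dX).
Proof.
move=> /is_derive_coord XdX.
rewrite (_ : (fun t => _) = (fun t => \sum_j (X t 0 j - z 0 j) ^+ 2)); last first.
  by apply/funext => s; rewrite sqr_norm; apply: eq_bigr => j _; rewrite !mxE expr2.
rewrite /dot mulr_sumr; apply: is_derive_fsum => j; rewrite !mxE.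
have XdXj := XdX j; pose Y : R -> R := (fun t => X t 0 j) - cst (z 0 j).
have YdY : is_derive t 1 Y (dX 0 j) by apply: is_derive_eq; rewrite subr0.
have -> : (fun t => (X t 0 j - z 0 j) ^+ 2) = Y ^+ 2.
  by apply/funext => s; rewrite fctE.
apply: is_derive_eq.
by rewrite /= /GRing.scale /= expr1 /Y !fctE; ring.
Qed.

Lemma within_dot_continuous (A : set R) e X :
  {within A, continuous X} -> {within A, continuous (fun t => dot e (X t))}.
Proof. by move=> cX t; apply: dot_cvg; [exact: cvg_cst | exact: cX]. Qed.

Lemma within_sqr_dist_continuous (A : set R) z X :
  {within A, continuous X} -> {within A, continuous (fun t => ⟦X t - z⟧ ^+ 2)}.
Proof.
move=> cX; have -> : (fun t => ⟦X t - z⟧ ^+ 2) = (fun t => dot (X t - z) (X t - z)).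
  by apply/funext => t; rewrite sqr_norm.
move=> t; have cXz : {for t, continuous (fun t : subspace A => X t - z)}.
  by apply: continuousB; [exact: cX | exact: cst_continuous].
exact: (dot_cvg _ cXz cXz).
Qed.

End VectorCalculus.

(** * Descent, displacement and balance *)

Section GeneralTools.
Context {R : realType}.

Lemma near_pinfty_after (P : R -> Prop) :
  (\forall t \near +oo, P t) -> exists2 T, 0 <= T & forall t, T <= t -> P t.
Proof.
move=> [N [_ hN]]; exists (`|N| + 1); first by rewrite addr_ge0.
by move=> t tN; apply: hN; have := ler_norm N; lra.
Qed.

Lemma finite_uniform_bound (I : finType) (P : I -> R -> Prop) :
  (forall i a b, a <= b -> P i a -> P i b) ->
  (forall i, exists a, P i a) -> exists2 a, 0 <= a & forall i, P i a.
Proof.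
move=> Pmono /choice[g hg]; exists (\sum_i `|g i|); first exact: sumr_ge0.
move=> i; apply: Pmono (hg i); apply: le_trans (ler_norm _) _.
by rewrite (bigD1 i)//= lerDl sumr_ge0.
Qed.

(** S plays the role of an unbounded clock: while U is above the level E it pays
    for each tick of S. Below E, a single step can raise U by at most b. *)
Lemma descent_eventually_below (U S : nat -> R) (E b : R) k0 :
  0 <= E -> 0 <= b -> (forall k, 0 <= U k) -> (forall k, S k <= S k.+1) ->
  (forall A, exists2 k, (k0 <= k)%N & A < S k) ->
  (forall k, (k0 <= k)%N -> U k.+1 <= U k + b) ->
  (forall k, (k0 <= k)%N -> E <= U k -> U k.+1 + S k.+1 <= U k + S k) ->
  exists2 k1, (k0 <= k1)%N & forall k, (k1 <= k)%N -> U k <= E + b.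
Proof.
move=> E0 b0 U0 Smono Sunb step drop.
have [k1 k01 Uk1] : exists2 k1, (k0 <= k1)%N & U k1 < E.
  apply: contrapT => noE.
  have ge k : (k0 <= k)%N -> E <= U k.
    by move=> k0k; rewrite leNgt; apply/negP => UkE; apply: noE; exists k.
  have tot m : U (k0 + m)%N + S (k0 + m)%N <= U k0 + S k0.
    elim: m => [|m IH]; first by rewrite addn0.
    rewrite addnS; apply: le_trans IH; apply: drop; first exact: leq_addr.
    by apply: ge; exact: leq_addr.
  have [k k0k Sk] := Sunb (U k0 + S k0).
  by have := tot (k - k0)%N; rewrite subnKC//; have := U0 k; lra.
exists k1 => // k /subnKC <-; elim: (k - k1)%N => [|m IH]; first by rewrite addn0; lra.
rewrite addnS; have k0m : (k0 <= k1 + m)%N by rewrite (leq_trans k01)// leq_addr.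
have [UE|EU] := ltP (U (k1 + m)%N) E; first by have := step _ k0m; lra.
by have := drop _ k0m EU; have := Smono (k1 + m)%N; lra.
Qed.

End GeneralTools.

Section PiecewiseVector.
Context {R : realType} {r : nat}.
Variables (tau : nat -> R) (d_w : R).
Hypothesis tau0 : tau 0%N = 0.
Hypothesis d_w_gt0 : 0 < d_w.
Hypothesis dwell : forall k, d_w <= tau k.+1 - tau k.

(** Testing the displacement against itself reduces the vector inequality to a
    scalar one, so that no integral of the speed is needed. *)
Lemma piecewise_displacement (X : R -> 'rV[R]_r) (psi : R -> R) (a b K : R) :
  {within `[0, +oo[, continuous X} -> {within `[0, +oo[, continuous psi} ->
  0 <= a -> a <= b ->
  (forall t, a < t < b -> off_switch tau t -> exists dX dpsi,
     [/\ is_derive t 1 X dX, is_derive t 1 psi dpsi & ⟦dX⟧ <= K - dpsi]) ->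
  ⟦X b - X a⟧ <= K * (b - a) + (psi a - psi b).
Proof.
move=> cX cpsi a0 ab hd; set e := X b - X a.
have [e0|e0] := eqVneq ⟦e⟧ 0.
  have : psi b - psi a <= K * (b - a).
    apply: (piecewise_increment tau0 d_w_gt0 dwell) => // t tab toff.
    have [dX [dpsi [_ dd le]]] := hd t tab toff.
    by exists dpsi => //; have := norm_ge0 dX; lra.
  by rewrite e0; lra.
have e_gt0 : 0 < ⟦e⟧ by rewrite lt0r e0 norm_ge0.
pose phi t := dot e (X t) + ⟦e⟧ * psi t.
have cphi : {within `[0, +oo[, continuous phi}.
  move=> t; apply: cvgD; first exact: within_dot_continuous.
  by apply: cvgM; [exact: cvg_cst | exact: cpsi].
have : phi b - phi a <= ⟦e⟧ * K * (b - a).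
  apply: (piecewise_increment tau0 d_w_gt0 dwell) => // t tab toff.
  have [dX [dpsi [Xd psid le]]] := hd t tab toff.
  exists (dot e dX + ⟦e⟧ * dpsi).
    by have eXd := is_derive_dot e Xd; apply: is_deriveD.
  have := dot_le_norm e dX; have := ler_wpM2l (norm_ge0 e) le.
  by rewrite mulrBr; lra.
have -> : phi b - phi a = ⟦e⟧ * (⟦e⟧ + (psi b - psi a)).
  have : dot e (X b) - dot e (X a) = ⟦e⟧ * ⟦e⟧ by rewrite -dotBr -/e -sqr_norm expr2.
  by rewrite /phi mulrDr => <-; ring.
by rewrite -mulrA ler_pM2l//; lra.
Qed.

End PiecewiseVector.

Section Balance.
Context {R : realType} {n r : nat}.

(** Column and row sums of the weights agree, so the squared norms of the y i
    cancel and only the disagreement remains. *)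
Lemma balanced_dissipation (a : 'M[R]_n) (y : 'I_n -> 'rV[R]_r) :
  (forall i, \sum_j a i j = \sum_j a j i) ->
  2 * \sum_i dot (y i) (\sum_j a i j *: (y j - y i)) =
  - \sum_i \sum_j a i j * ⟦y i - y j⟧ ^+ 2.
Proof.
move=> bal; have swap : \sum_i \sum_j a i j * ⟦y j⟧ ^+ 2 = \sum_i \sum_j a i j * ⟦y i⟧ ^+ 2.
  rewrite exchange_big /=; apply: eq_bigr => i _.
  by rewrite -!mulr_suml bal.
apply/eqP; rewrite -addr_eq0 mulr_sumr -big_split /=; apply/eqP.
apply: etrans (etrans (congr2 +%R swap (erefl (- _))) (subrr _)).
rewrite -sumrB; apply: eq_bigr => i _.
rewrite dot_sumr mulr_sumr -sumrB -big_split /=; apply: eq_bigr => j _.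
rewrite dotZr !sqr_norm dotBl !dotBr (dotC (y j) (y i)); ring.
Qed.

End Balance.

(** * Constrained consensus under a vanishing perturbation *)

(** The perturbation w is arbitrary here; for the closed loop it is the scaled
    gradient. *)
Section PerturbedConsensus.
Context {R : realType} {n r : nat}.
Variables (H : 'I_n -> set 'rV[R]_r) (eta etabar : R) (G : R -> wdigraph R n).
Variables (tau ts : nat -> R) (d_w M : R) (x w : 'I_n -> R -> 'rV[R]_r).
Hypothesis n_gt0 : (0 < n)%N.
Hypothesis H_closed : forall i, closed (H i).
Hypothesis H_convex : forall i, convex_set (H i).
Hypothesis H_neq0 : \bigcap_i H i !=set0.
Hypothesis eta_gt0 : 0 < eta.
Hypothesis eta_lt : eta < etabar.
Hypothesis G_adm : forall t : R, 0 <= t -> admissible eta etabar (G t).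
Hypothesis G_balanced : forall t : R, 0 <= t -> balanced (G t).
Hypothesis G_switch : switching_times G tau.
Hypothesis d_w_gt0 : 0 < d_w.
Hypothesis dwell : forall k, d_w <= tau k.+1 - tau k.
Hypothesis ts0 : ts 0%N = 0.
Hypothesis ts_switch : forall j, exists k, ts j = tau k.
Hypothesis ts_step : forall j, 0 < ts j.+1 - ts j <= M.
Hypothesis ts_conn :
  forall j, strongly_connected (union_edges G `[ts j, ts j.+1[).

Definition residual i t := x i t - euclid_proj (H i) (x i t).

Definition velocity i t : 'rV[R]_r :=
  \sum_j weight (G t) i j *: (x j t - x i t) - residual i t - w i t.

Hypothesis x_cont : forall i, {within `[0, +oo[, continuous (x i)}.
Hypothesis x_ode : forall i t, 0 <= t -> off_switch tau t ->
  is_derive t 1 (x i) (velocity i t).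

Definition sqr_deviation z t : R := \sum_i ⟦x i t - z⟧ ^+ 2.

Definition dissipation t : R :=
  \sum_i \sum_j weight (G t) i j * ⟦x i t - x j t⟧ ^+ 2 +
  2 * \sum_i ⟦residual i t⟧ ^+ 2.

Let tau0 : tau 0%N = 0. Proof. by case: G_switch. Qed.
Let HI := \bigcap_i H i.
Let HI_closed : closed HI. Proof. exact: closed_bigI. Qed.

Lemma weight_ge0 t i j : 0 <= t -> 0 <= weight (G t) i j.
Proof.
move=> t0; have [_ /(_ i j)[hin hout]] := G_adm t0.
have [/hin/andP[h _]|/hout->//] := boolP ((j, i) \in edges (G t)).
exact: le_trans (ltW eta_gt0) h.
Qed.

Lemma weight_le t i j : 0 <= t -> weight (G t) i j <= etabar.
Proof.
move=> t0; have [_ /(_ i j)[hin hout]] := G_adm t0.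
have [/hin/andP[]//|/hout->] := boolP ((j, i) \in edges (G t)).
exact/ltW/(lt_trans eta_gt0 eta_lt).
Qed.

Lemma dissipation_ge0 t : 0 <= t -> 0 <= dissipation t.
Proof.
move=> t0; rewrite addr_ge0 ?mulr_ge0 ?sumr_ge0// => i _; last exact: sqr_ge0.
by rewrite sumr_ge0// => j _; rewrite mulr_ge0 ?weight_ge0 ?sqr_ge0.
Qed.

Lemma local_le_dissipation t i : 0 <= t ->
  \sum_j weight (G t) i j * ⟦x i t - x j t⟧ ^+ 2 + ⟦residual i t⟧ ^+ 2 <= dissipation t.
Proof.
move=> t0; apply: lerD.
  rewrite [leRHS](bigD1 i)//= lerDl sumr_ge0// => k _; rewrite sumr_ge0// => l _.
  by rewrite mulr_ge0 ?weight_ge0 ?sqr_ge0.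
rewrite (bigD1 i)//=; have := sqr_ge0 ⟦residual i t⟧.
have : 0 <= \sum_(k | k != i) ⟦residual k t⟧ ^+ 2.
  by rewrite sumr_ge0// => k _; rewrite sqr_ge0.
lra.
Qed.

Lemma residual_le_dissipation t i : 0 <= t -> ⟦residual i t⟧ ^+ 2 <= dissipation t.
Proof.
move=> t0; apply: le_trans (local_le_dissipation i t0).
by rewrite lerDr sumr_ge0// => j _; rewrite mulr_ge0 ?weight_ge0 ?sqr_ge0.
Qed.

Lemma edge_le_dissipation t i j : 0 <= t -> (j, i) \in edges (G t) ->
  eta * ⟦x i t - x j t⟧ ^+ 2 <= dissipation t.
Proof.
move=> t0 ji; have [_ /(_ i j)[/(_ ji)/andP[eta_le _] _]] := G_adm t0.
apply: le_trans (local_le_dissipation i t0).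
rewrite (bigD1 j)//= -addrA; apply: ler_wpDr; last by rewrite ler_wpM2r ?sqr_ge0.
rewrite addr_ge0 ?sqr_ge0// sumr_ge0// => k _.
by rewrite mulr_ge0 ?weight_ge0 ?sqr_ge0.
Qed.

Lemma sqr_deviation_ge0 z t : 0 <= sqr_deviation z t.
Proof. by apply: sumr_ge0 => i _; rewrite sqr_ge0. Qed.

Lemma sqr_deviation_continuous z : {within `[0, +oo[, continuous (sqr_deviation z)}.
Proof. by apply: sum_continuous => i; exact: within_sqr_dist_continuous. Qed.

Lemma is_derive_sqr_deviation z t : 0 <= t -> off_switch tau t ->
  is_derive t 1 (sqr_deviation z) (2 * \sum_i dot (x i t - z) (velocity i t)).
Proof.
move=> t0 toff; rewrite mulr_sumr; apply: is_derive_fsum => i.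
by apply: is_derive_sqr_dist; exact: x_ode.
Qed.

(** Balance turns the coupling into a sum of squared disagreements, and the
    constraint terms push towards any common point z. *)
Lemma sqr_deviation_rate z t : HI z -> 0 <= t ->
  2 * \sum_i dot (x i t - z) (velocity i t) <=
  - dissipation t - 2 * \sum_i dot (x i t - z) (w i t).
Proof.
move=> Hz t0.
have -> : 2 * \sum_i dot (x i t - z) (velocity i t) =
    2 * \sum_i dot (x i t - z)
      (\sum_j weight (G t) i j *: ((x j t - z) - (x i t - z)))
    - 2 * \sum_i dot (x i t - z) (residual i t)
    - 2 * \sum_i dot (x i t - z) (w i t).
  rewrite -!mulrBr -!sumrB; congr (_ * _); apply: eq_bigr => i _.
  rewrite /velocity !dotBr; congr (_ - _ - _); congr (dot _ _).
  by apply: eq_bigr => j _; rewrite opprB addrA subrK.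
rewrite balanced_dissipation; last exact: G_balanced.
rewrite lerD2r /dissipation opprD lerD//.
  rewrite lerN2; apply: ler_sum => i _; apply: ler_sum => j _.
  by rewrite opprB addrA subrK.
rewrite lerN2 ler_pM2l//; apply: ler_sum => i _.
by apply: proj_residual_dot => //; exact: Hz.
Qed.

Lemma xbar_sum t : \sum_i (x i t - average x t) = 0.
Proof.
rewrite sumrB sumr_const card_ord -scaler_nat /average scalerA divff ?scale1r ?subrr//.
by rewrite pnatr_eq0 -lt0n.
Qed.

(** The deviations from the average add up to 0, so the cross terms cancel; the
    common point of K that fits the agents best is the projection of the average. *)
Lemma sqr_deviation_split z t : sqr_deviation z t =
  sqr_deviation (average x t) t + n%:R * ⟦average x t - z⟧ ^+ 2.
Proof.
have -> : n%:R * ⟦average x t - z⟧ ^+ 2 = \sum_(i < n) ⟦average x t - z⟧ ^+ 2.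
  by rewrite sum_ord_const.
have -> : sqr_deviation (average x t) t = sqr_deviation (average x t) t +
    2 * \sum_i dot (x i t - average x t) (average x t - z).
  by rewrite -dot_suml xbar_sum dot0l mulr0 addr0.
rewrite mulr_sumr -!big_split /=; apply: eq_bigr => i _.
have -> : x i t - z = (x i t - average x t) + (average x t - z).
  by rewrite addrA subrK.
move: (x i t - average x t) (average x t - z) => u v.
by rewrite !sqr_norm !dotDl !dotDr (dotC v u); ring.
Qed.

Lemma sqr_deviation_proj_le K z t : closed K -> K z ->
  sqr_deviation (euclid_proj K (average x t)) t <= sqr_deviation z t.
Proof.
move=> cK Kz; rewrite sqr_deviation_split [leRHS]sqr_deviation_split lerD2l.
by rewrite ler_wpM2l// ler_pXn2r ?nnegrE ?norm_ge0// proj_min.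
Qed.

Lemma sqr_deviation_term z t i : ⟦x i t - z⟧ ^+ 2 <= sqr_deviation z t.
Proof.
by rewrite /sqr_deviation (bigD1 i)//= lerDl sumr_ge0// => j _; rewrite sqr_ge0.
Qed.

Lemma average_norm_le (B : R) (v : 'rV[R]_r) t :
  (forall i, ⟦x i t - v⟧ <= B) -> ⟦average x t - v⟧ <= B.
Proof.
move=> xB; have n0 : n%:R != 0 :> R by rewrite pnatr_eq0 -lt0n.
have -> : average x t - v = n%:R^-1 *: \sum_i (x i t - v).
  by rewrite sumrB sumr_const card_ord -[v *+ n]scaler_nat scalerBr scalerA mulVf// scale1r.
rewrite norm_scale ger0_norm ?invr_ge0// ler_pdivrMl ?ltr0n//.
apply: le_trans (norm_sum _ _) _; apply: le_trans (ler_sum _ (fun i _ => xB i)) _.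
by rewrite sum_ord_const.
Qed.

Variable B : R.
Hypothesis x_bounded : forall i t, 0 <= t -> ⟦x i t⟧ <= B.

Let B_ge0 : 0 <= B.
Proof. exact: le_trans (norm_ge0 _) (x_bounded (Ordinal n_gt0) (lexx 0)). Qed.

(** Bounds the rate at which a perturbation of unit size can increase the squared
    deviation from a point of norm at most Bz. *)
Definition drift_coef (Bz : R) : R := 2 * (n%:R * (B + Bz)).

Lemma drift_coef_ge0 Bz : 0 <= Bz -> 0 <= drift_coef Bz.
Proof. by move=> h; rewrite !mulr_ge0 ?addr_ge0. Qed.

Lemma bounded_rate z (Bz e : R) t : HI z -> ⟦z⟧ <= Bz -> 0 <= t ->
  (forall i, ⟦w i t⟧ <= e) ->
  2 * \sum_i dot (x i t - z) (velocity i t) <= - dissipation t + drift_coef Bz * e.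
Proof.
move=> Hz zB t0 we; apply: le_trans (sqr_deviation_rate Hz t0) _.
rewrite lerD2l -mulrN /drift_coef -mulrA ler_pM2l// -sumrN.
have -> : n%:R * (B + Bz) * e = \sum_(i < n) (B + Bz) * e.
  by rewrite sum_ord_const mulrA.
apply: ler_sum => i _; rewrite -dotNl; apply: le_trans (dot_le_norm _ _) _.
rewrite norm_opp; apply: ler_pM => //; rewrite ?norm_ge0//.
apply: le_trans (norm_triangle _ _) _; rewrite norm_opp.
by rewrite lerD// x_bounded.
Qed.

Lemma bounded_increment z (Bz e a b : R) : HI z -> ⟦z⟧ <= Bz -> 0 <= a -> a <= b ->
  (forall i t, a <= t -> ⟦w i t⟧ <= e) ->
  sqr_deviation z b - sqr_deviation z a <= drift_coef Bz * e * (b - a).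
Proof.
move=> Hz zB a0 ab we.
apply: (@piecewise_increment _ _ _ tau0 d_w_gt0 dwell (sqr_deviation z)) => //.
  exact: sqr_deviation_continuous.
move=> t /andP[at_ tb] toff; have t0 : 0 <= t by lra.
exists (2 * \sum_i dot (x i t - z) (velocity i t)); first exact: is_derive_sqr_deviation.
have := bounded_rate Hz zB t0 (fun i => we i t (ltW at_)).
by have := dissipation_ge0 t0; lra.
Qed.

(** The free parameter kappa trades the linear growth of the speed against the
    quadratic dissipation. *)
Lemma velocity_le (kappa : R) i t : 0 < kappa -> 0 <= t ->
  ⟦velocity i t⟧ <= (n%:R * etabar + 1) * kappa + dissipation t / kappa + ⟦w i t⟧.
Proof.
move=> k0 t0.
(* A weak form of the inequality of arithmetic and geometric means. *)
have young y : 0 <= y -> y <= kappa + y ^+ 2 / kappa.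
  move=> y0; rewrite -lerBlDl ler_pdivlMr//; nra.
have h1 : ⟦\sum_j weight (G t) i j *: (x j t - x i t)⟧ <=
    n%:R * etabar * kappa + (\sum_j weight (G t) i j * ⟦x i t - x j t⟧ ^+ 2) / kappa.
  apply: le_trans (norm_sum _ _) _.
  have -> : n%:R * etabar * kappa = \sum_(j < n) etabar * kappa.
    by rewrite sum_ord_const mulrA.
  rewrite mulr_suml -big_split /=; apply: ler_sum => j _.
  have a0 := weight_ge0 i j t0; have a1 := weight_le i j t0.
  rewrite norm_scale ger0_norm// norm_distC.
  have := ler_wpM2l a0 (young _ (norm_ge0 (x i t - x j t))).
  by have := ler_wpM2r (ltW k0) a1; rewrite mulrDr mulrA; lra.
have h2 := young _ (norm_ge0 (residual i t)).
have := norm_triangle (\sum_j weight (G t) i j *: (x j t - x i t) - residual i t) (- w i t).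
have := norm_triangle (\sum_j weight (G t) i j *: (x j t - x i t)) (- residual i t).
rewrite -/(velocity i t) !norm_opp => h3 h4.
have : (\sum_j weight (G t) i j * ⟦x i t - x j t⟧ ^+ 2 + ⟦residual i t⟧ ^+ 2) / kappa
    <= dissipation t / kappa.
  by rewrite ler_pM2r ?invr_gt0// local_le_dissipation.
rewrite mulrDl; lra.
Qed.

(** Two distinct switching times are at least d_w apart. *)
Lemma ts_gap j : d_w <= ts j.+1 - ts j.
Proof.
have [k1 e1] := ts_switch j.+1; have [k0 e0] := ts_switch j.
have /andP[tslt _] := ts_step j; move: tslt; rewrite e1 e0 subr_gt0 => lt01.
have lt_k : (k0 < k1)%N.
  rewrite ltnNge; apply/negP => /(tau_le d_w_gt0 dwell); lra.
by have := tau_lt d_w_gt0 dwell lt_k; lra.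
Qed.

Lemma ts_ge0 j : 0 <= ts j.
Proof. exact: (tau_ge0 ts0 d_w_gt0 ts_gap). Qed.

Lemma window_len_gt0 : 0 < M.
Proof. by have /andP[h1 h2] := ts_step 0; exact: lt_le_trans h1 h2. Qed.

(** A path without repeated vertices has fewer than n edges. *)
Lemma connected_norm_le (E : {set 'I_n * 'I_n}) (y : 'I_n -> 'rV[R]_r) (c : R) i k :
  0 <= c -> (forall u v, (u, v) \in E -> ⟦y u - y v⟧ <= c) ->
  strongly_connected E -> ⟦y i - y k⟧ <= n%:R * c.
Proof.
move=> c0 Ec /(_ i k)/connectP[p0 /shortenP[p pth up _] ->].
have : ⟦y i - y (last i p)⟧ <= (size p)%:R * c.
  elim: p i pth {up p0} => [|v p IH] u /=.
    by rewrite subrr norm_zero mul0r.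
  move=> /andP[uv /IH h]; apply: le_trans (dist_triangle (y v) _ _) _.
  by rewrite -natr1 mulrDl mul1r addrC lerD// Ec.
move=> h; apply: le_trans h _; rewrite ler_wpM2r// ler_nat.
by have := max_card (mem (i :: p)); rewrite (card_uniqP up) card_ord /= => /ltnW.
Qed.

(** A window on which the squared deviation from z drops by at most kappa^2,
    under a perturbation of size kappa^2: positions are then frozen and in
    agreement up to a multiple of kappa. *)
Section Window.
Variables (z : 'rV[R]_r) (Bz kappa : R) (j : nat).
Hypothesis Hz : HI z.
Hypothesis zB : ⟦z⟧ <= Bz.
Hypothesis kappa_gt0 : 0 < kappa.
Hypothesis kappa_le1 : kappa <= 1.
Hypothesis w_small : forall i t, ts j <= t -> ⟦w i t⟧ <= kappa ^+ 2.
Hypothesis small_drop :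
  sqr_deviation z (ts j) - sqr_deviation z (ts j.+1) <= kappa ^+ 2.

Local Notation c0 := (drift_coef Bz).
(* In the three coefficients below, c0 accounts for the perturbation. The speed is
   at most speed_coef * kappa plus 1 / kappa times the rate of decrease of the
   squared deviation; over the window this moves an agent by at most
   frozen_coef * kappa. A dissipation above calm_coef * kappa^2 on a whole piece,
   whose length is at least d_w, would cost more than the drop allowed. *)
Definition speed_coef : R := n%:R * etabar + 2 + c0.
Definition frozen_coef : R := speed_coef * M + 1 + c0 * M.
Definition calm_coef : R := c0 + (2 + 2 * c0 * M) / d_w.

Let c0_ge0 : 0 <= c0.
Proof. by apply: drift_coef_ge0; exact: le_trans (norm_ge0 z) zB. Qed.

Let k2_le : kappa ^+ 2 <= kappa.
Proof. by rewrite expr2 ger_pMr. Qed.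

Let speed_coef_ge0 : 0 <= speed_coef.
Proof. by rewrite !addr_ge0// mulr_ge0// ltW// (lt_trans eta_gt0). Qed.

Let M_ge0 : 0 <= M. Proof. exact: ltW window_len_gt0. Qed.

Let c0M_ge0 : 0 <= 2 + 2 * c0 * M.
Proof. exact: addr_ge0 (ler0n _ 2) (mulr_ge0 (mulr_ge0 (ler0n _ 2) c0_ge0) M_ge0). Qed.

Let increment a b : ts j <= a -> a <= b -> b <= ts j.+1 ->
  sqr_deviation z b - sqr_deviation z a <= c0 * M * kappa ^+ 2.
Proof.
move=> ja ab bj; have a0 := le_trans (ts_ge0 j) ja.
have we i t : a <= t -> ⟦w i t⟧ <= kappa ^+ 2.
  by move=> at_; apply: w_small; exact: le_trans ja at_.
apply: le_trans (bounded_increment Hz zB a0 ab we) _.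
rewrite mulrAC ler_wpM2r ?sqr_ge0// ler_wpM2l//.
by have /andP[_] := ts_step j; lra.
Qed.

Lemma window_frozen i t : ts j <= t -> t <= ts j.+1 ->
  ⟦x i t - x i (ts j)⟧ <= frozen_coef * kappa.
Proof.
move=> jt tj; have j0 := ts_ge0 j; have k0 := kappa_gt0.
have cpsi : {within `[0, +oo[, continuous (fun t => kappa^-1 * sqr_deviation z t)}.
  by move=> s; apply: cvgM; [exact: cvg_cst | exact: sqr_deviation_continuous].
have := @piecewise_displacement _ _ _ _ tau0 d_w_gt0 dwell (x i)
  (fun t => kappa^-1 * sqr_deviation z t) (ts j) t (speed_coef * kappa)
  (@x_cont i) cpsi j0 jt.
move=> /(_ _)/le_trans; apply.
  move=> s /andP[js st] soff; have s0 : 0 <= s by lra.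
  exists (velocity i s), (kappa^-1 * (2 * \sum_i dot (x i s - z) (velocity i s))).
  split; first exact: x_ode.
    by have Vd := is_derive_sqr_deviation z s0 soff; apply: is_deriveZ.
  have ws k : ⟦w k s⟧ <= kappa ^+ 2 by apply: w_small; exact: ltW.
  apply: le_trans (velocity_le i kappa_gt0 s0) _.
  have rate := bounded_rate Hz zB s0 ws.
  move: (2 * _) rate => Y rate.
  have : dissipation s / kappa <= c0 * kappa - kappa^-1 * Y.
    rewrite ler_pdivrMr//.
    have -> : (c0 * kappa - kappa^-1 * Y) * kappa = c0 * kappa ^+ 2 - Y.
      by field; rewrite gt_eqF.
    lra.
  have := ws i; have := k2_le; rewrite /speed_coef !mulrDl; lra.
have k2 : kappa^-1 * kappa ^+ 2 = kappa by rewrite expr2 mulrA mulVf ?mul1r ?gt_eqF.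
have drop : sqr_deviation z (ts j) - sqr_deviation z t <= (1 + c0 * M) * kappa ^+ 2.
  by have := increment jt tj (lexx _); have := small_drop; lra.
have : kappa^-1 * (sqr_deviation z (ts j) - sqr_deviation z t) <= (1 + c0 * M) * kappa.
  by rewrite -[in leRHS]k2 mulrCA ler_pM2l ?invr_gt0.
have : speed_coef * kappa * (t - ts j) <= speed_coef * M * kappa.
  rewrite mulrAC ler_wpM2r ?(ltW kappa_gt0)// ler_wpM2l//.
  by have /andP[_] := ts_step j; lra.
rewrite /frozen_coef; lra.
Qed.

Lemma window_calm k : ts j <= tau k -> tau k.+1 <= ts j.+1 ->
  exists2 t, tau k < t < tau k.+1 & dissipation t <= calm_coef * kappa ^+ 2.
Proof.
move=> jk kj; have k0 := kappa_gt0; have gap := dwell k; have dw0 := d_w_gt0.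
have j0 := ts_ge0 j; apply: contrapT => noT.
have big t : tau k < t < tau k.+1 -> calm_coef * kappa ^+ 2 < dissipation t.
  by move=> tk; rewrite ltNge; apply/negP => h; apply: noT; exists t.
have ltk : tau k <= tau k.+1 by lra.
have tk0 : 0 <= tau k by lra.
have kk : sqr_deviation z (tau k.+1) - sqr_deviation z (tau k) <=
    - ((calm_coef - c0) * kappa ^+ 2) * (tau k.+1 - tau k).
  apply: (@piecewise_increment _ _ _ tau0 d_w_gt0 dwell (sqr_deviation z)) => //.
    exact: sqr_deviation_continuous.
  move=> t tk toff; have /andP[t1 t2] := tk; have t0 : 0 <= t by lra.
  exists (2 * \sum_i dot (x i t - z) (velocity i t)); first exact: is_derive_sqr_deviation.
  have ws i : ⟦w i t⟧ <= kappa ^+ 2 by apply: w_small; lra.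
  by have := bounded_rate Hz zB t0 ws; have := big t tk; lra.
have i1 := increment (lexx _) jk (le_trans ltk kj).
have i2 := increment (le_trans jk ltk) kj (lexx _).
have sd := small_drop.
have : (calm_coef - c0) * kappa ^+ 2 * d_w <=
    (calm_coef - c0) * kappa ^+ 2 * (tau k.+1 - tau k).
  rewrite ler_wpM2l// mulr_ge0 ?sqr_ge0// /calm_coef addrAC subrr add0r.
  by rewrite divr_ge0 ?(ltW dw0).
have -> : (calm_coef - c0) * kappa ^+ 2 * d_w = (2 + 2 * c0 * M) * kappa ^+ 2.
  by rewrite /calm_coef; field; rewrite gt_eqF.
have : 0 < kappa ^+ 2 by rewrite exprn_gt0.
lra.
Qed.

Let le_sqr_scale (u c : R) : 0 <= c -> u ^+ 2 <= c * kappa ^+ 2 -> u <= (1 + c) * kappa.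
Proof.
move=> cge0 h; have k0 := kappa_gt0; rewrite leNgt; apply/negP => hlt.
have : ((1 + c) * kappa) ^+ 2 < u ^+ 2.
  have ck0 : 0 <= (1 + c) * kappa by rewrite mulr_ge0 ?addr_ge0 ?(ltW k0).
  by rewrite ltr_pXn2r ?nnegrE// ltW// (le_lt_trans ck0 hlt).
have : 0 < kappa ^+ 2 by rewrite exprn_gt0.
rewrite exprMn; nra.
Qed.

Let calm_coef_ge0 : 0 <= calm_coef.
Proof. exact: addr_ge0 c0_ge0 (divr_ge0 c0M_ge0 (ltW d_w_gt0)). Qed.

Let frozen_coef_ge0 : 0 <= frozen_coef.
Proof.
exact: addr_ge0 (addr_ge0 (mulr_ge0 speed_coef_ge0 M_ge0) ler01) (mulr_ge0 c0_ge0 M_ge0).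
Qed.

Definition edge_coef : R := 2 * frozen_coef + (1 + calm_coef / eta).

(** The edge is active on a whole piece, which contains a calm time; positions at
    that time and at the start of the window differ little. *)
Lemma window_edge u v : (u, v) \in union_edges G `[ts j, ts j.+1[ ->
  ⟦x u (ts j) - x v (ts j)⟧ <= edge_coef * kappa.
Proof.
rewrite inE => /asboolP[t /=]; rewrite in_itv /= => /andP[jt tj] uvt.
have t0 := le_trans (ts_ge0 j) jt.
have [k /andP[kt tk]] := tau_piece tau0 d_w_gt0 dwell t0.
have jk : ts j <= tau k.
  have [l jl] := ts_switch j; rewrite jl (tau_le d_w_gt0 dwell)//.
  by apply: (tau_le_of_lt d_w_gt0 dwell); rewrite -jl (le_lt_trans jt).
have kj : tau k.+1 <= ts j.+1.
  have [l jl] := ts_switch j.+1; rewrite jl (tau_le d_w_gt0 dwell)//.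
  rewrite ltnNge; apply/negP => /(tau_le d_w_gt0 dwell).
  by rewrite -jl; move: (le_lt_trans kt tj); lra.
have [s ks] := window_calm jk kj; have /andP[ks1 ks2] := ks => ds.
have s0 : 0 <= s by have := ts_ge0 j; lra.
have uvs : (u, v) \in edges (G s).
  case: G_switch => _ _ Gc; rewrite (Gc k) ?(ltW ks1)//.
  by rewrite (Gc k t) ?kt// in uvt.
have js : ts j <= s by lra.
have sj : s <= ts j.+1 by lra.
have := window_frozen u js sj; have := window_frozen v js sj.
have hs : ⟦x v s - x u s⟧ <= (1 + calm_coef / eta) * kappa.
  apply: le_sqr_scale; first by rewrite divr_ge0 ?(ltW eta_gt0).
  rewrite mulrAC ler_pdivlMr// mulrC; apply: le_trans ds.
  exact: edge_le_dissipation.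
have := dist_triangle (x u s) (x u (ts j)) (x v (ts j)).
have := dist_triangle (x v s) (x u s) (x v (ts j)).
rewrite (norm_distC (x u (ts j)) (x u s)) (norm_distC (x u s) (x v s)).
by rewrite /edge_coef; lra.
Qed.

Lemma window_residual i : ⟦residual i (ts j)⟧ <= (frozen_coef + 1 + calm_coef) * kappa.
Proof.
have [k jk] := ts_switch j; have [l jl] := ts_switch j.+1.
have kj : tau k.+1 <= ts j.+1.
  rewrite jl (tau_le d_w_gt0 dwell)// ltnNge; apply/negP => /(tau_le d_w_gt0 dwell).
  by rewrite -jl -jk; have /andP[] := ts_step j; lra.
have jk' : ts j <= tau k by rewrite jk.
have [s /andP[ks1 ks2] ds] := window_calm jk' kj.
have js : ts j <= s by lra.
have sj : s <= ts j.+1 by lra.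
have s0 : 0 <= s by have := ts_ge0 j; lra.
have hs : ⟦residual i s⟧ <= (1 + calm_coef) * kappa.
  by apply: le_sqr_scale => //; exact: le_trans (residual_le_dissipation i s0) ds.
have [h Hh] := H_neq0; have Hi0 : H i !=set0 by exists h; exact: Hh.
apply: le_trans (dist_proj_lipschitz _ (x i s) (@H_closed i) Hi0) _.
rewrite -/(residual i s) norm_distC -[frozen_coef + 1 + _]addrA mulrDl.
by apply: lerD => //; exact: window_frozen.
Qed.

Lemma window_agreement i k :
  ⟦x i (ts j) - x k (ts j)⟧ <= n%:R * edge_coef * kappa.
Proof.
rewrite -mulrA.
apply: (@connected_norm_le _ (fun i => x i (ts j)) _ i k _ _ (ts_conn j)) => [|u v];
  last exact: window_edge.
apply: mulr_ge0 (ltW kappa_gt0); apply: addr_ge0 (mulr_ge0 (ler0n _ 2) frozen_coef_ge0) _.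
exact: addr_ge0 ler01 (divr_ge0 calm_coef_ge0 (ltW eta_gt0)).
Qed.

End Window.

Lemma proj_average_norm_le K z0 t : closed K -> K z0 -> 0 <= t ->
  ⟦euclid_proj K (average x t)⟧ <= 2 * B + ⟦z0⟧.
Proof.
move=> cK Kz t0; have avgB : ⟦average x t⟧ <= B.
  rewrite -[average x t]subr0; apply: average_norm_le => i.
  by rewrite subr0 x_bounded.
have := proj_min (average x t) cK Kz.
have := dist_triangle (average x t) (euclid_proj K (average x t)) 0.
have := dist_triangle 0 (average x t) z0; rewrite !subr0 !sub0r norm_opp.
rewrite (norm_distC (euclid_proj _ _)); lra.
Qed.

(** The least squared deviation of the agents from a common feasible point. *)
Definition feasible_deviation t := sqr_deviation (euclid_proj HI (average x t)) t.

(** With a smaller drop over the window, the agents would nearly agree and nearly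
    satisfy every constraint at its start, and the deviation there would be
    smaller than e. *)
Lemma feasible_deviation_drop (Bz e : R) :
  (forall t, 0 <= t -> ⟦euclid_proj HI (average x t)⟧ <= Bz) -> 0 < e ->
  exists2 delta, 0 < delta & forall j,
    (forall i t, ts j <= t -> ⟦w i t⟧ <= delta) ->
    e <= feasible_deviation (ts j) ->
    feasible_deviation (ts j.+1) <= feasible_deviation (ts j) - delta.
Proof.
move=> projB e0; have n0 : 0 < n%:R :> R by rewrite ltr0n.
have [e1 [e1_gt0 e1_le1 e1_le]] : exists e1 : R, [/\ 0 < e1, e1 <= 1 & n%:R * e1 <= e / 4].
  exists (Num.min 1 (e / 4 / n%:R)); rewrite lt_min ltr01 ge_min lexx !divr_gt0//; split=> //.
  by rewrite mulrC -ler_pdivlMr// ge_min lexx orbT.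
have e1sq : n%:R * e1 ^+ 2 <= e / 4.
  by apply: le_trans e1_le; rewrite ler_pM2l// expr2 ger_pMr.
have [sigma s0 near_HI] := near_intersection B H_closed H_neq0 e1_gt0.
(* A * kappa bounds disagreement and residuals together; it has to be below e1 for
   the first, and twice that below sigma for the use of near_HI at the average. *)
set A := n%:R * edge_coef Bz + (frozen_coef Bz + 1 + calm_coef Bz).
have [kappa [k0 k1 kA]] : exists kappa : R,
    [/\ 0 < kappa, kappa <= 1 & `|A| * kappa <= Num.min e1 (sigma / 2)].
  have m0 : 0 < Num.min e1 (sigma / 2) by rewrite lt_min e1_gt0 divr_gt0.
  exists (Num.min 1 (Num.min e1 (sigma / 2) / (`|A| + 1))).
  have A1 : 0 < `|A| + 1 by rewrite ltr_wpDl.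
  rewrite lt_min ltr01 ge_min lexx divr_gt0//; split=> //.
  apply: (@le_trans _ _ ((`|A| + 1) * (Num.min e1 (sigma / 2) / (`|A| + 1)))).
    by rewrite ler_pM// ?lerDl// ?ge_min ?lexx ?orbT// le_min ler01 ltW// divr_gt0.
  by rewrite mulrC divfK// gt_eqF.
exists (kappa ^+ 2); first by rewrite exprn_gt0.
move=> j wj far; set T := ts j; set z := euclid_proj HI (average x T).
have T0 : 0 <= T by exact: ts_ge0.
have Hz : HI z by exact: proj_in.
have Hi0 i : H i !=set0 by exists z; exact: Hz.
apply: (@le_trans _ _ (sqr_deviation z (ts j.+1))); first exact: sqr_deviation_proj_le.
rewrite leNgt; apply/negP => small.
have small_drop : sqr_deviation z (ts j) - sqr_deviation z (ts j.+1) <= kappa ^+ 2.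
  by move: small; rewrite /feasible_deviation -/T -/z; lra.
have [agree res] : (forall i k, ⟦x i T - x k T⟧ <= n%:R * edge_coef Bz * kappa) /\
    (forall i, ⟦residual i T⟧ <= (frozen_coef Bz + 1 + calm_coef Bz) * kappa).
  split=> [i k|i]; [apply: (@window_agreement z) => // | apply: (@window_residual z) => //];
  exact: projB.
have coef1 : 0 <= n%:R * edge_coef Bz * kappa.
  exact: le_trans (norm_ge0 _) (agree (Ordinal n_gt0) (Ordinal n_gt0)).
have coef2 : 0 <= (frozen_coef Bz + 1 + calm_coef Bz) * kappa.
  exact: le_trans (norm_ge0 _) (res (Ordinal n_gt0)).
have AK : A * kappa <= Num.min e1 (sigma / 2).
  by apply: le_trans kA; rewrite ler_wpM2r ?(ltW k0)// ler_norm.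
move: AK; rewrite le_min /A mulrDl => /andP[Ae1 As].
have avg_close i : ⟦x i T - average x T⟧ <= n%:R * edge_coef Bz * kappa.
  by rewrite norm_distC; apply: average_norm_le => k; exact: agree.
have avgB : ⟦average x T⟧ <= B.
  by rewrite -[average x T]subr0; apply: average_norm_le => i; rewrite subr0 x_bounded.
have : ⟦average x T - z⟧ <= e1.
  apply: near_HI => // i.
  apply: le_trans (dist_proj_lipschitz _ (x i T) (@H_closed i) (Hi0 i)) _.
  rewrite norm_distC -/(residual i T).
  apply: le_trans (lerD (avg_close i) (res i)) (le_trans As _).
  by rewrite ler_pdivrMr// ler_peMr ?(ltW s0)// ler1n.
rewrite -(ler_pXn2r (n := 2)) ?nnegrE ?norm_ge0 ?(ltW e1_gt0)// => close.
have dev : sqr_deviation (average x T) T <= n%:R * e1 ^+ 2.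
  have -> : n%:R * e1 ^+ 2 = \sum_(i < n) e1 ^+ 2.
    by rewrite sum_ord_const.
  apply: ler_sum => i _; rewrite ler_pXn2r ?nnegrE ?norm_ge0 ?(ltW e1_gt0)//.
  by apply: le_trans (avg_close i) (le_trans _ Ae1); rewrite lerDl.
move: far; rewrite /feasible_deviation -/T -/z sqr_deviation_split.
by have := ler_wpM2l (ltW n0) close; lra.
Qed.

(** Every window lowers the deviation by a fixed amount as long as it is not small,
    and the perturbation can restore only a vanishing part of it. *)
Theorem perturbed_consensus :
  (forall e, 0 < e -> \forall t \near +oo, forall i, ⟦w i t⟧ <= e) ->
  forall e, 0 < e -> \forall t \near +oo, feasible_deviation t <= e.
Proof.
have pay (u v s d : R) : u <= v - d -> u + (s + d) <= v + s by lra.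
move=> w_vanish e e0; have [z0 Hz0] := H_neq0.
pose Bz := 2 * B + ⟦z0⟧; have M0 := window_len_gt0.
have projB t : 0 <= t -> ⟦euclid_proj HI (average x t)⟧ <= Bz by exact: proj_average_norm_le.
have c0 : 0 <= drift_coef Bz.
  by apply: drift_coef_ge0; apply: le_trans (projB 0 (lexx 0)); exact: norm_ge0.
have e3 : 0 < e / 3 by rewrite divr_gt0.
have [delta d0 drop] := feasible_deviation_drop projB e3.
pose p := Num.min delta (e / 3 / (drift_coef Bz * M + 1)).
have cM1 : 0 < drift_coef Bz * M + 1 by rewrite ltr_wpDl// mulr_ge0// ltW.
have p0 : 0 < p by rewrite lt_min d0 divr_gt0.
have pe : drift_coef Bz * p * M <= e / 3.
  have : p * (drift_coef Bz * M + 1) <= e / 3.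
    by rewrite -ler_pdivlMr// ge_min lexx orbT.
  by rewrite mulrDr mulr1; lra.
have [T T0 wT] := near_pinfty_after (w_vanish p p0).
have [j0 Tj0] := tau_unbounded ts0 d_w_gt0 ts_gap T.
have Tj j : (j0 <= j)%N -> T <= ts j by move=> /(tau_le d_w_gt0 ts_gap); exact: le_trans.
have step j t : (j0 <= j)%N -> ts j <= t -> t <= ts j.+1 ->
    feasible_deviation t <= feasible_deviation (ts j) + e / 3.
  move=> j0j jt tj; have T0j := ts_ge0 j.
  have Hz : HI (euclid_proj HI (average x (ts j))) by exact: proj_in.
  apply: le_trans (sqr_deviation_proj_le t HI_closed Hz) _.
  have wj i s : ts j <= s -> ⟦w i s⟧ <= p.
    by move=> js; apply: wT; exact: le_trans (Tj _ j0j) js.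
  have := bounded_increment Hz (projB _ T0j) T0j jt wj.
  have : drift_coef Bz * p * (t - ts j) <= drift_coef Bz * p * M.
    apply: (ler_wpM2l (mulr_ge0 c0 (ltW p0))).
    by have /andP[_] := ts_step j; lra.
  by move=> h1 h2; rewrite -lerBlDl; exact: le_trans h2 (le_trans h1 pe).
have [|||||||j1 j01 below] := @descent_eventually_below _ (fun j => feasible_deviation (ts j))
  (fun j => delta * j%:R) (e / 3) (e / 3) j0.
- exact: ltW.
- exact: ltW.
- by move=> j; exact: sqr_deviation_ge0.
- by move=> j; rewrite ler_pM2l// ler_nat.
- move=> A; exists (maxn j0 (Num.trunc (`|A| / delta)).+1); first exact: leq_maxl.
  rewrite mulrC -ltr_pdivrMr//; apply: (@le_lt_trans _ _ (`|A| / delta)).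
    by rewrite ler_pM2r ?invr_gt0// ler_norm.
  apply: lt_le_trans (truncnS_gt _) _; rewrite ler_nat; exact: leq_maxr.
- by move=> j j0j; apply: step => //; have /andP[] := ts_step j; lra.
- move=> j j0j far; rewrite -natr1 mulrDr mulr1.
  have wj i s : ts j <= s -> ⟦w i s⟧ <= delta.
    move=> js; apply: (@le_trans _ _ p); last by rewrite ge_min lexx.
    by apply: wT; exact: le_trans (Tj _ j0j) js.
  exact: pay (drop j wj far).
exists (ts j1); split; first exact: num_real.
move=> t /ltW j1t.
have [j /andP[jt tj]] := tau_piece ts0 d_w_gt0 ts_gap (le_trans (ts_ge0 j1) j1t).
have j1j : (j1 <= j)%N by apply: (tau_le_of_lt d_w_gt0 ts_gap); exact: le_lt_trans j1t tj.
apply: le_trans (step j t (leq_trans j01 j1j) jt (ltW tj)) _.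
have {2}-> : e = e / 3 + e / 3 + e / 3 by field.
by rewrite lerD2r below.
Qed.

End PerturbedConsensus.

(** * Gains and boundedness of the closed loop *)

Section GainRate.
Context {R : realType}.

Lemma atan_expR_lipschitz (a b : R) : atan (expR a) - atan (expR b) <= `|a - b|.
Proof.
have [ab|ba] := leP a b.
  apply: (@le_trans _ _ 0) => //.
  by rewrite subr_le0; apply: le_atan; rewrite ler_expR.
rewrite ger0_norm ?subr_ge0 ?(ltW ba)//.
have dg (y : R) : is_derive y 1 (atan \o expR) ((1 + expR y ^+ 2)^-1 * expR y).
  exact: is_derive1_comp.
have cg : {within `[b, a], continuous (atan \o (@expR R))}.
  apply: continuous_subspaceT => y; apply: differentiable_continuous.
  by apply/derivable1_diffP; exact: ex_derive.
have [c _ /= ->] := MVT ba (fun y _ => dg y) cg.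
rewrite ler_piMl ?subr_ge0 ?(ltW ba)// mulrC ler_pdivrMr ?mul1r; last first.
  by rewrite ltr_wpDr ?sqr_ge0.
(* The derivative e^c / (1 + e^(2c)) is below 1. *)
have := sqr_ge0 (expR c - 1); have := expR_gt0 c; nra.
Qed.

Lemma atan_expR_ge (y : R) : 0 <= y -> pi / 4 <= atan (expR y).
Proof. by move=> y0; rewrite -atan1 le_atan// -expR0 ler_expR. Qed.

End GainRate.

Section ClosedLoopBound.
Context {R : realType} {n r : nat}.
Variables (f : 'I_n -> 'rV[R]_r -> R) (H : 'I_n -> set 'rV[R]_r).
Variables (eta etabar : R) (G : R -> wdigraph R n).
Variables (tau ts : nat -> R) (d_w M : R) (x : 'I_n -> R -> 'rV[R]_r) (q : 'I_n -> R -> R).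
Hypothesis n_gt0 : (0 < n)%N.
Hypothesis f_diff : forall i (s : 'rV[R]_r), differentiable (f i) s.
Hypothesis f_convex : forall i, convex_function setT (f i).
Hypothesis H_closed : forall i, closed (H i).
Hypothesis H_convex : forall i, convex_set (H i).
Hypothesis eta_gt0 : 0 < eta.
Hypothesis eta_lt : eta < etabar.
Hypothesis G_adm : forall t : R, 0 <= t -> admissible eta etabar (G t).
Hypothesis G_switch : switching_times G tau.
Hypothesis G_balanced : forall t : R, 0 <= t -> balanced (G t).
Hypothesis X_neq0 : forall i, critical_points (f i) !=set0.
Hypothesis X_bounded : forall i, bounded_set (critical_points (f i)).
Hypothesis H_neq0 : \bigcap_i H i !=set0.
Hypothesis d_w_gt0 : 0 < d_w.
Hypothesis dwell : forall k, d_w <= tau k.+1 - tau k.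
Hypothesis ts0 : ts 0%N = 0.
Hypothesis ts_switch : forall j, exists k, ts j = tau k.
Hypothesis ts_step : forall j, 0 < ts j.+1 - ts j <= M.
Hypothesis ts_conn :
  forall j, strongly_connected (union_edges G `[ts j, ts j.+1[).
Hypothesis traj : closed_loop_trajectory f H G tau x q.

Let tau0 : tau 0%N = 0. Proof. by case: G_switch. Qed.

Definition gradient_term i t : 'rV[R]_r :=
  (Num.sqrt (q i t))^-1 *: gradient (f i) (x i t).

Local Notation vel := (velocity H G x gradient_term).
Local Notation dev := (sqr_deviation x).

Lemma control_velocity i t : 0 <= t -> control f H G x q i t = vel i t.
Proof.
move=> t0; rewrite /control /velocity; congr (_ - _ - _).
rewrite big_mkcond /=; apply: eq_bigr => j _; case: ifPn => //; rewrite inE => ji.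
by have [_ /(_ i j)[_ ->]] := G_adm t0; rewrite ?scale0r.
Qed.

Let x_cont i : {within `[0, +oo[, continuous (x i)}.
Proof. by case: (traj i). Qed.

Let x_ode i t : 0 <= t -> off_switch tau t -> is_derive t 1 (x i) (vel i t).
Proof. by move=> t0 toff; rewrite -control_velocity//; case: (traj i) => _ _ _ /(_ t t0 toff). Qed.

Let le_max_l (a b : R) : a <= Num.max a b. Proof. by rewrite le_max lexx. Qed.
Let le_max_r (a b : R) : b <= Num.max a b. Proof. by rewrite le_max lexx orbT. Qed.

(** The exponential of a norm is at least 1, so the rate of q i lies between
    pi / 4 and pi / 2 whatever the trajectory does. *)
Lemma q_growth i t : 0 <= t ->
  q i 0 + pi / 4 * t <= q i t /\ q i t <= q i 0 + pi / 2 * t.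
Proof.
move=> t0; have [_ cq _ _ dq] := traj i.
have := @piecewise_increment_ge _ _ _ tau0 d_w_gt0 dwell (q i) 0 t (pi / 4) cq (lexx 0) t0.
have := @piecewise_increment _ _ _ tau0 d_w_gt0 dwell (q i) 0 t (pi / 2) cq (lexx 0) t0.
rewrite subr0 => h1 h2.
suff [l1 l2] : pi / 4 * t <= q i t - q i 0 /\ q i t - q i 0 <= pi / 2 * t by lra.
split; [apply: h2|apply: h1] => s /andP[s0 _] soff;
  exists (atan (expR ⟦x i s⟧)) => //; try exact: dq (ltW s0) soff.
- by rewrite atan_expR_ge// norm_ge0.
- exact/ltW/atan_ltpi2.
Qed.

Lemma q_linear : exists a b, [/\ 0 < a, 0 < b &
  forall i t, 0 <= t -> a * (1 + t) <= q i t <= b * (1 + t)].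
Proof.
have q0 i : 0 < q i 0 by case: (traj i).
have [c c0 hc] := @finite_uniform_bound R 'I_n (fun i c => (q i 0)^-1 <= c /\ q i 0 <= c)
  (fun i a b ab h => conj (le_trans h.1 ab) (le_trans h.2 ab))
  (fun i => ex_intro _ (Num.max (q i 0)^-1 (q i 0))
    (conj (le_max_l _ _) (le_max_r _ _))).
have pi0 := pi_gt0 R; exists (Num.min (pi / 4) (c + 1)^-1), (pi / 2 + c).
have c1 : 0 < c + 1 by rewrite ltr_wpDl.
split; [by rewrite lt_min !divr_gt0 ?invr_gt0 | by rewrite ltr_wpDr ?divr_gt0 |].
move=> i t t0; have [lo hi] := q_growth i t0; have [qc1 qc2] := hc i.
apply/andP; split.
  apply: le_trans lo; rewrite mulrDr mulr1; apply: lerD.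
    rewrite ge_min; apply/orP; right.
    rewrite -[leRHS]invrK lef_pV2 ?posrE ?invr_gt0//.
    by rewrite (le_trans qc1)// lerDl.
  by rewrite ler_wpM2r// ge_min lexx.
have P0 : 0 <= pi / 2 :> R by rewrite divr_ge0 ?(ltW pi0).
move: (pi / 2) P0 hi => P P0 hi; apply: le_trans hi _; rewrite mulrDr mulr1 mulrDl.
have ct : 0 <= c * t by rewrite mulr_ge0.
apply: lerD; last by rewrite lerDl.
by apply: le_trans qc2 _; rewrite lerDr.
Qed.

(** Since q i grows linearly, this ratio of the actual gain to the common gain
    1 / sqrt (1 + t) stays within positive bounds. *)
Definition gain_ratio i t : R := Num.sqrt ((1 + t) / q i t).

Lemma q_gt0 i t : 0 <= t -> 0 < q i t.
Proof.
move=> t0; have [a [b [a0 b0 hq]]] := q_linear; have /andP[+ _] := hq i t t0.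
by apply: lt_le_trans; rewrite mulr_gt0// ltr_pwDl.
Qed.

Lemma gain_ratioE i t : 0 <= t ->
  (Num.sqrt (q i t))^-1 = gain_ratio i t / Num.sqrt (1 + t).
Proof.
move=> t0; have t1 : 0 < 1 + t by rewrite ltr_pwDl.
rewrite /gain_ratio sqrtrM ?(ltW t1)// sqrtrV ?(ltW (q_gt0 i t0))//.
by rewrite mulrAC divff ?mul1r// gt_eqF// sqrtr_gt0.
Qed.

Lemma sqr_gain_ratio i t : 0 <= t -> gain_ratio i t ^+ 2 = (1 + t) / q i t.
Proof.
move=> t0; rewrite sqr_sqrtr// divr_ge0 ?(ltW (q_gt0 i t0))//.
by rewrite addr_ge0.
Qed.

Lemma gain_ratio_bounds : exists c1 c2, [/\ 0 < c1, 0 < c2 &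
  forall i t, 0 <= t -> c1 <= gain_ratio i t <= c2].
Proof.
have [a [b [a0 b0 hq]]] := q_linear.
exists (Num.sqrt b^-1), (Num.sqrt a^-1); rewrite !sqrtr_gt0 !invr_gt0; split => // i t t0.
have t1 : 0 < 1 + t by rewrite ltr_pwDl.
have /andP[lo hi] := hq i t t0; have qt0 := q_gt0 i t0.
apply/andP; split; apply: ler_wsqrtr.
  by rewrite ler_pdivlMr// mulrC ler_pdivrMr// mulrC.
by rewrite ler_pdivrMr// mulrC ler_pdivlMr// mulrC.
Qed.

(** The dissipation is dropped, and the tangent inequality bounds the gradient
    terms by excess values. *)
Lemma objective_rate z t : (\bigcap_i H i) z -> 0 <= t ->
  2 * \sum_i dot (x i t - z) (vel i t) <=
  - (2 / Num.sqrt (1 + t) * \sum_i gain_ratio i t * (f i (x i t) - f i z)).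
Proof.
move=> Hz t0; apply: le_trans (sqr_deviation_rate _ _ H_closed H_convex G_balanced Hz t0) _.
have D0 := dissipation_ge0 H x eta_gt0 G_adm t0.
apply: (@le_trans _ _ (- (2 * \sum_i dot (x i t - z) (gradient_term i t)))).
  by rewrite -[leRHS]add0r lerD2r oppr_le0.
rewrite lerN2 -mulrA ler_pM2l// mulr_sumr; apply: ler_sum => i _.
rewrite mulrA [_^-1 * _]mulrC -gain_ratioE// dotZr ler_wpM2l ?invr_ge0 ?sqrtr_ge0//.
have := @convex_above_tangent R r (f i) (f_diff i) (f_convex i) (x i t) z.
rewrite (dotC (x i t - z)) -[x i t - z]opprB dotNr; lra.
Qed.

(** Far from the optimum the coercive objectives dominate: the squared distance
    to a feasible point z0 cannot increase while some agent is far away. *)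
Lemma trajectories_bounded : exists B, forall i t, 0 <= t -> ⟦x i t⟧ <= B.
Proof.
have [c1 [c2 [c1_gt0 c2_gt0 hc]]] := gain_ratio_bounds.
have [z0 Hz0] := H_neq0.
have [kap kap0 hkap] : exists2 kap, 0 <= kap & forall i s, f i z0 - kap <= f i s.
  apply: (@finite_uniform_bound R 'I_n (fun i kap => forall s, f i z0 - kap <= f i s)).
    by move=> i a b ab h s; apply: le_trans (h s); rewrite lerD2l lerN2.
  move=> i; have [c fc] := X_neq0 i; exists (f i z0 - f i c) => s.
  by rewrite opprB addrC subrK; exact: critical_point_min.
(* An excess of K at one agent outweighs a deficit of kap at each agent, since the
   ratio of two gains is at most c2 / c1. *)
pose K := n%:R * kap * c2 / c1.
have K0 : 0 <= K by rewrite divr_ge0 ?(ltW c1_gt0)// !mulr_ge0 ?(ltW c2_gt0).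
have [Rad Rad0 hRad] : exists2 Rad, 0 <= Rad & forall i s, Rad <= ⟦s⟧ -> f i z0 + K <= f i s.
  apply: (@finite_uniform_bound R 'I_n (fun i a => forall s, a <= ⟦s⟧ -> f i z0 + K <= f i s)).
    by move=> i a b ab h s bs; apply: h; exact: le_trans bs.
  by move=> i; exact: convex_coercive.
pose L := Num.max (dev z0 0) (n%:R * (Rad + ⟦z0⟧) ^+ 2).
have Rz0 : 0 <= Rad + ⟦z0⟧ by rewrite addr_ge0 ?norm_ge0.
have devL t : 0 <= t -> dev z0 t <= L.
  apply: (@piecewise_barrier _ _ _ tau0 d_w_gt0 dwell (dev z0) L).
  - exact: sqr_deviation_continuous.
  - by rewrite le_max lexx.
  move=> s s0 soff; exists (2 * \sum_i dot (x i s - z0) (vel i s)).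
    exact: (is_derive_sqr_deviation x_ode _ (ltW s0) soff).
  move=> Ls; apply: le_trans (objective_rate Hz0 (ltW s0)) _.
  rewrite oppr_le0 mulr_ge0 ?divr_ge0 ?sqrtr_ge0//.
  have [i far] : exists i, Rad <= ⟦x i s⟧.
    apply: contrapT => /forallNP near; have : dev z0 s <= L; last by rewrite leNgt Ls.
    rewrite le_max; apply/orP; right.
    have -> : n%:R * (Rad + ⟦z0⟧) ^+ 2 = \sum_(i < n) (Rad + ⟦z0⟧) ^+ 2.
      by rewrite sum_ord_const.
    apply: ler_sum => i _; rewrite ler_pXn2r ?nnegrE ?norm_ge0//.
    apply: le_trans (norm_triangle _ _) _; rewrite norm_opp lerD2r ltW// ltNge.
    exact/negP/near.
  have term j : - (c2 * kap) <= gain_ratio j s * (f j (x j s) - f j z0).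
    have /andP[lo hi] := hc j s (ltW s0); have h := hkap j (x j s).
    have g0 := le_trans (ltW c1_gt0) lo.
    apply: (@le_trans _ _ (gain_ratio j s * - kap)).
      by rewrite mulrN lerN2 ler_wpM2r.
    by rewrite ler_wpM2l//; lra.
  have termi : n%:R * (c2 * kap) <= gain_ratio i s * (f i (x i s) - f i z0).
    have /andP[lo hi] := hc i s (ltW s0).
    apply: (@le_trans _ _ (c1 * K)).
      have -> // : c1 * K = n%:R * (c2 * kap) by rewrite /K; field; rewrite gt_eqF.
    by apply: ler_pM; rewrite ?(ltW c1_gt0)//; have := hRad i _ far; lra.
  rewrite (bigD1 i)//=.
  have rest : - (n%:R * (c2 * kap)) <= \sum_(j | j != i) gain_ratio j s * (f j (x j s) - f j z0).
    apply: (@le_trans _ _ (\sum_(j | j != i) - (c2 * kap))); last exact: ler_sum.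
    rewrite sumr_const mulNrn lerN2 -[leLHS]mulr_natl ler_wpM2r ?mulr_ge0 ?(ltW c2_gt0)//.
    by rewrite ler_nat (leq_trans (max_card _))// card_ord.
  by have := lerD termi rest; rewrite subrr.
have L0 : 0 <= L by apply: le_trans (devL 0 (lexx 0)); exact: sqr_deviation_ge0.
exists (Num.sqrt L + ⟦z0⟧) => i t t0.
have := dist_triangle z0 (x i t) 0; rewrite !subr0.
suff : ⟦x i t - z0⟧ <= Num.sqrt L by lra.
rewrite -(ler_pXn2r (n := 2)) ?nnegrE ?norm_ge0 ?sqrtr_ge0// (sqr_sqrtr L0).
by apply: le_trans (devL t t0); exact: sqr_deviation_term.
Qed.

(** * Asymptotic agreement of positions and gains *)

Variable B : R.
Hypothesis x_bounded : forall i t, 0 <= t -> ⟦x i t⟧ <= B.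

Local Notation HI := (\bigcap_i H i).
Local Notation avg := (average x).

Let HI_closed : closed HI. Proof. exact: closed_bigI. Qed.

Lemma inv_sqrt_vanish (e : R) : 0 < e -> \forall t \near +oo, (Num.sqrt (1 + t))^-1 <= e.
Proof.
move=> e0; exists (e^-1 ^+ 2); split; first exact: num_real.
move=> t /= et; rewrite -[leRHS]invrK lef_pV2 ?posrE ?invr_gt0//; last first.
  by rewrite sqrtr_gt0 ltr_pwDl// ltW// (le_lt_trans _ et)// sqr_ge0.
rewrite -[leLHS](@ger0_norm _ e^-1) ?invr_ge0 ?(ltW e0)// -sqrtr_sqr.
by apply: ler_wsqrtr; lra.
Qed.

Lemma gradient_term_vanish (e : R) : 0 < e ->
  \forall t \near +oo, forall i, ⟦gradient_term i t⟧ <= e.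
Proof.
move=> e0; have [c1 [c2 [c1_gt0 c2_gt0 hc]]] := gain_ratio_bounds.
have [L L0 hL] : exists2 L, 0 <= L & forall i s, ⟦s⟧ <= B -> ⟦gradient (f i) s⟧ <= L.
  apply: (@finite_uniform_bound R 'I_n
    (fun i L => forall s, ⟦s⟧ <= B -> ⟦gradient (f i) s⟧ <= L)).
    by move=> i a b ab h s sB; exact: le_trans (h s sB) ab.
  by move=> i; have [L _ hL] := gradient_bounded (f_diff i) (@f_convex i) B; exists L.
have cL : 0 < c2 * L + 1 by rewrite ltr_wpDl// mulr_ge0// ltW.
have ec : 0 < e / (c2 * L + 1) by rewrite divr_gt0.
near=> t => i; have t0 : 0 <= t by near: t; exact/nbhs_pinfty_ge/num_real.
have st : (Num.sqrt (1 + t))^-1 <= e / (c2 * L + 1) by near: t; exact: inv_sqrt_vanish.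
rewrite /gradient_term norm_scale ger0_norm ?invr_ge0 ?sqrtr_ge0// gain_ratioE//.
have /andP[lo hi] := hc i t t0.
rewrite mulrAC; apply: (@le_trans _ _ ((c2 * L) * (e / (c2 * L + 1)))).
  apply: ler_pM => //; rewrite ?invr_ge0 ?sqrtr_ge0// ?mulr_ge0 ?norm_ge0 ?sqrtr_ge0//.
  by apply: ler_pM; rewrite ?norm_ge0 ?sqrtr_ge0 ?hL ?x_bounded.
by rewrite mulrCA ger_pMr// ler_pdivrMr// mul1r lerDl.
Unshelve. all: by end_near. Qed.

(** The gradient terms vanish, so they are admissible perturbations of the
    consensus dynamics. *)
Lemma near_feasible (e : R) : 0 < e ->
  \forall t \near +oo, forall i, ⟦x i t - euclid_proj HI (avg t)⟧ <= e.
Proof.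
move=> e0; have e2 : 0 < e ^+ 2 by rewrite exprn_gt0.
have := perturbed_consensus n_gt0 H_closed H_convex H_neq0 eta_gt0 eta_lt G_adm
  G_balanced G_switch d_w_gt0 dwell ts0 ts_switch ts_step ts_conn x_cont x_ode
  x_bounded gradient_term_vanish e2.
apply: filterS => t ht i; rewrite -(ler_pXn2r (n := 2)) ?nnegrE ?norm_ge0 ?(ltW e0)//.
by apply: le_trans ht; exact: sqr_deviation_term.
Qed.

Lemma near_agreement (e : R) : 0 < e -> \forall t \near +oo,
  [/\ forall i k, ⟦x i t - x k t⟧ <= e, forall i, ⟦x i t - avg t⟧ <= e,
      ⟦avg t - euclid_proj HI (avg t)⟧ <= e & forall i, ⟦residual H x i t⟧ <= e].
Proof.
move=> e0; have e2 : 0 < e / 2 by rewrite divr_gt0.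
apply: filterS (near_feasible e2) => t; set z := euclid_proj HI (avg t) => ht.
have e2e : e / 2 <= e by lra.
have avgz : ⟦avg t - z⟧ <= e / 2 by exact: average_norm_le.
have pair u v : ⟦u - z⟧ <= e / 2 -> ⟦v - z⟧ <= e / 2 -> ⟦u - v⟧ <= e.
  by have := dist_triangle z u v; rewrite (norm_distC z v); lra.
split => [i k|i||i]; try exact: pair; first exact: le_trans avgz e2e.
have Hz : HI z by exact: proj_in.
by apply: le_trans (le_trans (ht i) e2e); apply: proj_min => //; exact: Hz.
Qed.

Lemma velocity_vanish (e : R) : 0 < e -> \forall t \near +oo, forall i, ⟦vel i t⟧ <= e.
Proof.
move=> e0; have etabar0 := lt_trans eta_gt0 eta_lt.
have c0 : 0 < n%:R * etabar + 2 by rewrite ltr_wpDl// mulr_ge0// ltW.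
have e'0 : 0 < e / (n%:R * etabar + 2) by rewrite divr_gt0.
near=> t => i; have t0 : 0 <= t by near: t; exact/nbhs_pinfty_ge/num_real.
have [pairs _ _ res] : [/\ forall i k, ⟦x i t - x k t⟧ <= e / (n%:R * etabar + 2),
    forall i, ⟦x i t - avg t⟧ <= e / (n%:R * etabar + 2),
    ⟦avg t - euclid_proj HI (avg t)⟧ <= e / (n%:R * etabar + 2) &
    forall i, ⟦residual H x i t⟧ <= e / (n%:R * etabar + 2)].
  by near: t; exact: near_agreement.
have wt : forall i, ⟦gradient_term i t⟧ <= e / (n%:R * etabar + 2).
  by near: t; exact: gradient_term_vanish.
have -> : e = n%:R * (etabar * (e / (n%:R * etabar + 2))) +
    e / (n%:R * etabar + 2) + e / (n%:R * etabar + 2) by field; rewrite gt_eqF.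
apply: le_trans (norm_triangle _ _) _; rewrite norm_opp lerD//.
apply: le_trans (norm_triangle _ _) _; rewrite norm_opp lerD//.
apply: le_trans (norm_sum _ _) _.
rewrite -sum_ord_const; apply: ler_sum => j _.
rewrite norm_scale ger0_norm ?(weight_ge0 eta_gt0 G_adm)//.
by apply: ler_pM; rewrite ?norm_ge0 ?(weight_ge0 eta_gt0 G_adm) ?(weight_le eta_gt0 eta_lt G_adm).
Unshelve. all: by end_near. Qed.

(** The derivative of q i depends on the position of agent i only, and the
    positions merge; hence q i - q k grows sublinearly and the gains become
    equal in proportion. *)
Lemma gain_ratio_agree (e : R) : 0 < e ->
  \forall t \near +oo, forall i k, gain_ratio i t - gain_ratio k t <= e.
Proof.
move=> e0; have [c1 [c2 [c1_gt0 c2_gt0 hc]]] := gain_ratio_bounds.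
have [a [b [a0 b0 hq]]] := q_linear.
(* A difference of gain ratios above e makes their squares differ by more than
   e * c1, whereas 2 * e1 / a^2 bounds the difference of squares. *)
pose e1 := e * c1 * a ^+ 2 / 4; have e1_gt0 : 0 < e1.
  by rewrite divr_gt0// mulr_gt0 ?exprn_gt0// mulr_gt0.
have [T T0 agree] := near_pinfty_after (near_agreement e1_gt0).
(* C bounds the difference q i - q k at time T. *)
pose C := b * (1 + T).
near=> t; have Tt : T <= t by near: t; exact/nbhs_pinfty_ge/num_real.
have Ct : C / e1 <= t by near: t; exact/nbhs_pinfty_ge/num_real.
have t0 := le_trans T0 Tt.
have qdiff i k : q i t - q k t <= 2 * e1 * (1 + t).
  have [_ ci _ _ di] := traj i; have [_ ck _ _ dk] := traj k.
  have cd : {within `[0, +oo[, continuous (fun t => q i t - q k t)}.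
    by move=> s; apply: cvgB; [exact: ci | exact: ck].
  have := @piecewise_increment _ _ _ tau0 d_w_gt0 dwell _ T t e1 cd T0 Tt.
  have /andP[_ qiT] := hq i T T0; have qkT := q_gt0 k T0.
  have Ct' : C <= e1 * t by rewrite mulrC -ler_pdivrMr.
  have eT : 0 <= e1 * T by rewrite mulr_ge0// ltW.
  suff hd : forall s, T < s < t -> off_switch tau s ->
      exists2 d, is_derive s 1 (fun t => q i t - q k t) d & d <= e1.
    by move=> /(_ hd); rewrite -/C in qiT; lra.
  move=> s /andP[Ts _] soff; have s0 : 0 <= s by lra.
  have dis := di s s0 soff; have dks := dk s s0 soff.
  exists (atan (expR ⟦x i s⟧) - atan (expR ⟦x k s⟧)); first exact: is_deriveB.
  apply: le_trans (atan_expR_lipschitz _ _) _.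
  have [/(_ i k) pair _ _ _] := agree s (ltW Ts).
  have := dist_triangle (x k s) (x i s) 0; have := dist_triangle (x i s) (x k s) 0.
  by rewrite !subr0 (norm_distC (x k s)) ler_norml => h1 h2; apply/andP; split; lra.
move=> i k; rewrite leNgt; apply/negP => big.
have /andP[lo_i _] := hc i t t0; have /andP[lo_k _] := hc k t t0.
have sq : e * c1 < gain_ratio i t ^+ 2 - gain_ratio k t ^+ 2.
  rewrite subr_sqr; apply: (@lt_le_trans _ _ ((gain_ratio i t - gain_ratio k t) * c1)).
    by rewrite ltr_pM2r.
  by rewrite ler_wpM2l//; lra.
move: sq; rewrite !sqr_gain_ratio//.
have := q_gt0 i t0; have := q_gt0 k t0.
have /andP[lqi _] := hq i t t0; have /andP[lqk _] := hq k t t0.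
have u0 : 0 < 1 + t by rewrite ltr_pwDl.
move: (qdiff k i) lqi lqk; move: (q i t) (q k t) (1 + t) u0 => Q P u u0 qd aQ aP P0 Q0.
have aaQP : (a * u) * (a * u) <= Q * P.
  by apply: ler_pM => //; rewrite mulr_ge0// ltW.
have -> : u / Q - u / P = u * (P - Q) / (Q * P) by field; rewrite !gt_eqF.
rewrite ltr_pdivlMr ?mulr_gt0//; apply/negP; rewrite -leNgt.
apply: (@le_trans _ _ (u * (2 * e1 * u))); first by rewrite ler_pM2l.
have -> : u * (2 * e1 * u) = (e * c1) * ((a * u) * (a * u) / 2) by rewrite /e1; field.
rewrite ler_pM2l ?mulr_gt0// ler_pdivrMr//.
have : 0 <= Q * P by rewrite mulr_ge0// ltW.
lra.
Unshelve. all: by end_near. Qed.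

(** * Convergence to the optimal set *)

Definition objective s : R := \sum_i f i s.

Local Notation optima := (minimizers HI objective).

Let objective_continuous : continuous objective.
Proof. by apply: sum_continuous => i; exact: diff_fun_continuous. Qed.

Lemma optima_exist : exists s, optima s.
Proof.
apply: coercive_has_minimizer => // c.
have /choice[m hm] : forall i, exists m, forall s, m <= f i s.
  by move=> i; have [v fv] := X_neq0 i; exists (f i v) => s; exact: critical_point_min.
pose i0 := Ordinal n_gt0.
have [Rad hRad] := convex_coercive (f_diff i0) (@f_convex i0) (X_neq0 i0) (@X_bounded i0)
  (c - \sum_(i | i != i0) m i).
exists Rad => s sRad; rewrite /objective (bigD1 i0)//= -lerBlDr.
apply: le_trans (hRad s sRad); rewrite lerD2l lerN2.
by apply: ler_sum => i _; exact: hm.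
Qed.

Let optima_closed : closed optima. Proof. exact: minimizers_closed. Qed.

Lemma uniform_lipschitz (B' : R) : exists2 L, 0 <= L & forall i s y,
  ⟦s⟧ <= B' -> ⟦y⟧ <= B' -> f i s - f i y <= L * ⟦s - y⟧.
Proof.
apply: (@finite_uniform_bound R 'I_n (fun i L => forall s y,
  ⟦s⟧ <= B' -> ⟦y⟧ <= B' -> f i s - f i y <= L * ⟦s - y⟧)).
  move=> i a b ab h s y sB yB; apply: le_trans (h s y sB yB) _.
  by rewrite ler_wpM2r ?norm_ge0.
by move=> i; have [L _ hL] := convex_lipschitz (f_diff i) (@f_convex i) B'; exists L.
Qed.

(** Near consensus and feasibility, with almost equal gains, the weighted sum of
    excess values is close to a multiple of the excess of the total objective at
    the average, which is bounded below away from the optima. *)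
Lemma objective_gap (Bz e : R) : 0 < e -> B <= Bz -> exists2 c, 0 < c &
  \forall t \near +oo, forall z, optima z -> ⟦z⟧ <= Bz ->
    e <= ⟦avg t - euclid_proj optima (avg t)⟧ ->
    c <= \sum_i gain_ratio i t * (f i (x i t) - f i z).
Proof.
move=> e0 BBz; have [c1 [c2 [c1_gt0 c2_gt0 hc]]] := gain_ratio_bounds.
have [zs zs_opt] := optima_exist.
have [d d0 hd] := excess_away_from_minimizers B HI_closed objective_continuous zs_opt e0.
have [L L0 hL] := uniform_lipschitz Bz.
have B0 : 0 <= B by apply: le_trans (x_bounded (Ordinal n_gt0) (lexx 0)); exact: norm_ge0.
have n0 : 0 < n%:R :> R by rewrite ltr0n.
(* e1 absorbs the error made by evaluating each f i at the average, and e2 the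
   error made by replacing all gains by that of agent i0. *)
pose e1 := Num.min (d / 2) (d / 4 / (n%:R * (L + 1))).
have e1_gt0 : 0 < e1 by rewrite lt_min !divr_gt0// mulr_gt0// ltr_wpDl.
pose e2 := c1 * d / 4 / (n%:R * (L * (2 * Bz) + 1)).
have LB1 : 0 < L * (2 * Bz) + 1 by rewrite ltr_wpDl// !mulr_ge0// (le_trans B0).
have e2_gt0 : 0 < e2 by rewrite divr_gt0 ?mulr_gt0 ?divr_gt0// mulr_gt0.
exists (c1 * d / 2); first by rewrite divr_gt0// mulr_gt0.
near=> t => z z_opt zB far; have t0 : 0 <= t by near: t; exact/nbhs_pinfty_ge/num_real.
have [_ agree feas _] : [/\ forall i k, ⟦x i t - x k t⟧ <= e1,
    forall i, ⟦x i t - avg t⟧ <= e1, ⟦avg t - euclid_proj HI (avg t)⟧ <= e1 &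
    forall i, ⟦residual H x i t⟧ <= e1] by near: t; exact: near_agreement.
have gains : forall i k, gain_ratio i t - gain_ratio k t <= e2.
  by near: t; exact: gain_ratio_agree.
pose i0 := Ordinal n_gt0; have /andP[lo0 _] := hc i0 t t0.
have avgB : ⟦avg t⟧ <= B.
  by rewrite -[avg t]subr0; apply: average_norm_le => // i; rewrite subr0 x_bounded.
have excess : d <= \sum_i (f i (avg t) - f i z).
  rewrite sumrB -/(objective (avg t)) -/(objective z).
  have -> : objective z = objective zs.
    by case: z_opt zs_opt => HIz zmin [HIs smin]; apply: le_anti; rewrite zmin// smin.
  rewrite lerBrDl; apply: hd => //; apply: le_lt_trans feas _.
  by rewrite gt_min ltr_pdivrMr// ltr_pMr// ltr1n.
have term i : gain_ratio i0 t * (f i (avg t) - f i z - L * e1) - e2 * (L * (2 * Bz)) <=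
    gain_ratio i t * (f i (x i t) - f i z).
  have xB : ⟦x i t⟧ <= Bz by exact: le_trans (x_bounded i t0) BBz.
  have avgBz : ⟦avg t⟧ <= Bz by exact: le_trans avgB BBz.
  have h1 : f i (avg t) - f i (x i t) <= L * e1.
    apply: le_trans (hL i _ _ avgBz xB) _; rewrite ler_wpM2l// norm_distC.
    exact: agree.
  have zx : ⟦z - x i t⟧ <= 2 * Bz.
    by apply: le_trans (norm_triangle _ _) _; rewrite norm_opp; lra.
  have h2 : f i (x i t) - f i z <= L * (2 * Bz).
    by apply: le_trans (hL i _ _ xB zB) _; rewrite ler_wpM2l// norm_distC.
  have h3 : f i z - f i (x i t) <= L * (2 * Bz).
    by apply: le_trans (hL i _ _ zB xB) _; rewrite ler_wpM2l.
  have main : gain_ratio i0 t * (f i (avg t) - f i z - L * e1) <=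
      gain_ratio i0 t * (f i (x i t) - f i z).
    by rewrite ler_wpM2l ?(le_trans (ltW c1_gt0))//; lra.
  have err : (gain_ratio i0 t - gain_ratio i t) * (f i (x i t) - f i z) <= e2 * (L * (2 * Bz)).
    apply: le_trans (ler_norm _) _; rewrite normrM; apply: ler_pM => //; rewrite ler_norml.
      by have := gains i0 i; have := gains i i0 => g1 g2; apply/andP; split; lra.
    by apply/andP; split; lra.
  by move: err; rewrite mulrBl; lra.
apply: (@le_trans _ _ (\sum_i (gain_ratio i0 t * (f i (avg t) - f i z - L * e1)
  - e2 * (L * (2 * Bz))))); last exact: ler_sum.
rewrite sumrB -mulr_sumr sumrB !sum_ord_const.
have small1 : n%:R * (L * e1) <= d / 4.
  apply: (@le_trans _ _ (n%:R * (L + 1) * e1)).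
    by rewrite mulrA ler_wpM2r ?(ltW e1_gt0)// ler_pM2l// lerDl.
  by rewrite mulrC -ler_pdivlMr ?mulr_gt0 ?ltr_wpDl// ge_min lexx orbT.
have small2 : n%:R * (e2 * (L * (2 * Bz))) <= c1 * d / 4.
  apply: (@le_trans _ _ (e2 * (n%:R * (L * (2 * Bz) + 1)))).
    by rewrite mulrCA ler_pM2l// ler_pM2l// lerDl.
  by rewrite divfK// gt_eqF// mulr_gt0.
have : c1 * (d - d / 4) <= gain_ratio i0 t * (\sum_i (f i (avg t) - f i z) - n%:R * (L * e1)).
  by apply: ler_pM; rewrite ?(ltW c1_gt0)//; lra.
lra.
Unshelve. all: by end_near. Qed.

(** The least squared deviation of the agents from a common optimum. *)
Definition optimal_deviation t := dev (euclid_proj optima (avg t)) t.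

Let increment_off z (Bz p a b : R) : HI z -> ⟦z⟧ <= Bz -> 0 <= a -> a <= b ->
  (forall i t, a <= t -> ⟦gradient_term i t⟧ <= p) ->
  dev z b - dev z a <= drift_coef (n := n) B Bz * p * (b - a).
Proof.
exact: (bounded_increment H_closed H_convex eta_gt0 G_adm G_balanced G_switch
  d_w_gt0 dwell x_cont x_ode x_bounded).
Qed.

Lemma average_displacement (v a b : R) : 0 <= a -> a <= b ->
  (forall i t, a <= t -> ⟦vel i t⟧ <= v) -> ⟦avg b - avg a⟧ <= v * (b - a).
Proof.
move=> a0 ab slow; have move_i i : ⟦x i b - x i a⟧ <= v * (b - a).
  have c0 : {within `[0, +oo[, continuous (fun _ : R => 0 : R)}.
    by apply: continuous_subspaceT => s; exact: cst_continuous.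
  have := @piecewise_displacement _ _ _ _ tau0 d_w_gt0 dwell (x i) (fun=> 0) a b v
    (@x_cont i) c0 a0 ab.
  rewrite subrr addr0; apply => t /andP[at_ tb] toff; have t0 : 0 <= t by lra.
  exists (vel i t), 0; split; [exact: x_ode | exact: is_derive_cst |].
  by rewrite subr0; apply: slow; exact: ltW.
have := @average_norm_le R n r (fun i (_ : R) => x i b - x i a) n_gt0 (v * (b - a)) 0 0.
rewrite subr0 => /(_ _); rewrite /average sumrB scalerBr; apply.
by move=> i; rewrite subr0.
Qed.

(** The square root serves as the clock of the descent: its increments are below
    the guaranteed drops, and it is unbounded. *)
Lemma sqrt_clock (c : R) (k : nat) : 0 < c ->
  c * Num.sqrt k.+3%:R - c * Num.sqrt k.+2%:R <= c / Num.sqrt k.+2%:R.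
Proof.
move=> c0; rewrite -mulrBr ler_pM2l// -[leRHS]mul1r ler_pdivlMr ?sqrtr_gt0 ?ltr0n//.
set a := Num.sqrt k.+2%:R; set b := Num.sqrt k.+3%:R.
have b2 : b ^+ 2 = a ^+ 2 + 1 by rewrite !sqr_sqrtr// natr1.
have ab : a <= b by rewrite ler_wsqrtr// ler_nat.
have a0 : 0 <= a by exact: sqrtr_ge0.
by clearbody a b; nra.
Qed.

(** Over the unit window [k, k + 1] the deviation from the optimum chosen at time
    k drops by at least c / sqrt (k + 2), unless it is already small. These drops
    are not summable. *)
Theorem optimal_deviation_vanish (e : R) : 0 < e ->
  \forall t \near +oo, optimal_deviation t <= e.
Proof.
have pay (u v d s s' : R) : u - v <= - d -> s' - s <= d -> u + s' <= v + s by lra.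
have remain (u v w d : R) : 2 * d <= u -> u <= v + w -> v <= d -> d <= w by lra.
move=> e0; have [zs zs_opt] := optima_exist.
have B0 : 0 <= B by apply: le_trans (x_bounded (Ordinal n_gt0) (lexx 0)); exact: norm_ge0.
have n0 : 0 < n%:R :> R by rewrite ltr0n.
pose Bz := 2 * B + ⟦zs⟧.
have BBz : B <= Bz by have := norm_ge0 zs; rewrite /Bz; lra.
pose P t := euclid_proj optima (avg t).
have Popt t : optima (P t) by apply: proj_in => //; exists zs.
have PHI t : HI (P t) by case: (Popt t).
have PBz t : 0 <= t -> ⟦P t⟧ <= Bz.
  by move=> t0; exact: (proj_average_norm_le n_gt0 x_bounded).
(* A deviation of e / 3, minus the part n * eps^2 due to disagreement, leaves a
   distance of 2 * eps to the optima, of which the motion uses up eps. *)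
have [eps [eps0 eps_e]] : exists eps : R, 0 < eps /\ 5 * (n%:R * eps ^+ 2) <= e / 3.
  exists (Num.min 1 (e / (15 * n%:R))); split.
    by rewrite lt_min ltr01 divr_gt0// mulr_gt0// ltr0n.
  set m := Num.min _ _.
  have m0 : 0 <= m by rewrite le_min ler01 divr_ge0 ?(ltW e0)// mulr_ge0// ler0n.
  have m1 : m <= 1 by rewrite ge_min lexx.
  have : m ^+ 2 <= e / (15 * n%:R).
    by apply: (@le_trans _ _ m); [rewrite expr2 ler_piMr// | rewrite ge_min lexx orbT].
  by rewrite ler_pdivlMr ?mulr_gt0//; lra.
have [c c0 gap] := objective_gap eps0 BBz.
have dc0 : 0 <= drift_coef (n := n) B Bz.
  exact: mulr_ge0 (ler0n _ 2) (mulr_ge0 (ler0n _ n) (addr_ge0 B0 (le_trans B0 BBz))).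
pose p := e / 3 / (drift_coef (n := n) B Bz + 1).
have p0 : 0 < p by rewrite !divr_gt0// ltr_wpDl.
have pe : drift_coef (n := n) B Bz * p <= e / 3.
  rewrite /p mulrCA ger_pMr ?divr_gt0// ler_pdivrMr ?ltr_wpDl// mul1r.
  by rewrite lerDl.
have [T1 T10 agree] := near_pinfty_after (near_agreement eps0).
have [T2 T20 slow] := near_pinfty_after (velocity_vanish eps0).
have [T3 T30 gapT] := near_pinfty_after gap.
have [T4 T40 grad_small] := near_pinfty_after (gradient_term_vanish p0).
pose clock (k : nat) : R := k%:R.
have clock0 : clock 0%N = 0 by [].
have clock1 k : 1 <= clock k.+1 - clock k by rewrite /clock -natr1; lra.
have [k0 hk0] := tau_unbounded clock0 ltr01 clock1 (T1 + T2 + T3 + T4).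
have late k t : (k0 <= k)%N -> k%:R <= t -> [/\ T1 <= t, T2 <= t, T3 <= t & T4 <= t].
  move=> k0k kt; have := le_trans (le_trans hk0 (tau_le ltr01 clock1 k0k)) kt.
  by split; lra.
have step k t : (k0 <= k)%N -> k%:R <= t -> t <= k.+1%:R ->
    optimal_deviation t <= optimal_deviation k%:R + e / 3.
  move=> k0k kt tk; apply: (@le_trans _ _ (dev (P k%:R) t)).
    exact: sqr_deviation_proj_le.
  rewrite -lerBlDl; apply: le_trans (@increment_off _ Bz p k%:R t _ _ _ kt _) _ => //.
  - exact: PBz.
  - by move=> i s ks; have [_ _ _ T4s] := late k s k0k ks; exact: grad_small.
  apply: le_trans pe; rewrite -[leRHS]mulr1 ler_wpM2l ?(mulr_ge0 dc0 (ltW p0))//.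
  by move: tk; rewrite -natr1; lra.
have far k : (k0 <= k)%N -> e / 3 <= optimal_deviation k%:R ->
    forall t, k%:R <= t -> t <= k.+1%:R -> eps <= ⟦avg t - P t⟧.
  move=> k0k big t kt tk; have k0' : 0 <= k%:R :> R by [].
  have close i : ⟦x i k%:R - avg k%:R⟧ <= eps.
    by have [T1k _ _ _] := late k _ k0k (lexx _); have [] := agree _ T1k.
  have dev_avg : dev (avg k%:R) k%:R <= n%:R * eps ^+ 2.
    rewrite -sum_ord_const; apply: ler_sum => i _.
    by rewrite ler_pXn2r ?nnegrE ?norm_ge0 ?(ltW eps0).
  have dist2 : 2 * eps <= ⟦avg k%:R - P k%:R⟧.
    rewrite -(ler_pXn2r (n := 2)) ?nnegrE ?norm_ge0 ?mulr_ge0 ?(ltW eps0)//.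
    rewrite -(ler_pM2l n0) -(lerD2l (n%:R * eps ^+ 2)).
    apply: le_trans (lerD dev_avg (lexx _)); rewrite -(sqr_deviation_split x n_gt0).
    apply: le_trans big; apply: le_trans eps_e.
    have -> // : n%:R * eps ^+ 2 + n%:R * (2 * eps) ^+ 2 = 5 * (n%:R * eps ^+ 2) by ring.
  have moved : ⟦avg t - avg k%:R⟧ <= eps.
    have sl i s : k%:R <= s -> ⟦vel i s⟧ <= eps.
      by move=> ks; have [_ T2s _ _] := late k s k0k ks; exact: slow.
    apply: le_trans (average_displacement k0' kt sl) _.
    by rewrite ger_pMr// lerBlDr addrC natr1.
  rewrite norm_distC in moved.
  have tri : ⟦avg k%:R - P k%:R⟧ <= ⟦avg k%:R - avg t⟧ + ⟦avg t - P t⟧.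
    exact: dist_proj_lipschitz optima_closed (ex_intro _ zs zs_opt).
  exact: remain dist2 tri moved.
pose S (k : nat) := c * Num.sqrt k.+2%:R.
have drop k : (k0 <= k)%N -> e / 3 <= optimal_deviation k%:R ->
    optimal_deviation k.+1%:R + S k.+1 <= optimal_deviation k%:R + S k.
  move=> k0k big; apply: pay (sqrt_clock k c0).
  have k0' : 0 <= k%:R :> R by [].
  have kk : k%:R <= k.+1%:R :> R by rewrite ler_nat.
  have k1k : k.+1%:R - k%:R = 1 :> R by rewrite -natr1 addrAC subrr add0r.
  apply: (@le_trans _ _ (dev (P k%:R) k.+1%:R - dev (P k%:R) k%:R)).
    by rewrite lerD2r; exact: sqr_deviation_proj_le.
  have -> : - (c / Num.sqrt k.+2%:R) = - (c / Num.sqrt k.+2%:R) * (k.+1%:R - k%:R).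
    by rewrite k1k mulr1.
  apply: (@piecewise_increment _ _ _ tau0 d_w_gt0 dwell (dev (P k%:R))) => //.
    exact: sqr_deviation_continuous.
  move=> t /andP[kt tk] toff; have t0 : 0 <= t by exact: le_trans k0' (ltW kt).
  exists (2 * \sum_i dot (x i t - P k%:R) (vel i t)).
    exact: (is_derive_sqr_deviation x_ode _ t0 toff).
  apply: le_trans (objective_rate (PHI _) t0) _; rewrite lerN2 mulrC.
  have [_ _ T3t _] := late k t k0k (ltW kt).
  have c_le := gapT t T3t (P k%:R) (Popt _) (PBz _ k0') (far k k0k big t (ltW kt) (ltW tk)).
  apply: ler_pM => //; first exact: ltW.
  have st : 0 < Num.sqrt (1 + t) by rewrite sqrtr_gt0 ltr_pwDl.
  apply: (@le_trans _ _ (Num.sqrt (1 + t))^-1).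
    rewrite lef_pV2 ?posrE ?sqrtr_gt0 ?ltr0n ?ltr_pwDl//; apply: ler_wsqrtr.
    by rewrite -natr1 addrC lerD2r ltW.
  by rewrite ler_peMl ?invr_ge0 ?(ltW st)// ler1n.
have S_unbounded A : exists2 k, (k0 <= k)%N & A < S k.
  exists (maxn k0 (Num.trunc ((A / c) ^+ 2)).+1); first exact: leq_maxl.
  rewrite /S mulrC -ltr_pdivrMr//; apply: le_lt_trans (ler_norm _) _.
  rewrite -sqrtr_sqr ltr_sqrt ?ltr0n//; apply: lt_le_trans (truncnS_gt _) _.
  by rewrite ler_nat (leq_trans (leq_maxr k0 _))// ltnW.
have e3 : 0 <= e / 3 by rewrite divr_ge0// ltW.
have Smono k : S k <= S k.+1 by rewrite ler_pM2l// ler_wsqrtr// ler_nat.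
have U0 k : 0 <= optimal_deviation k%:R by exact: sqr_deviation_ge0.
have stepS k : (k0 <= k)%N -> optimal_deviation k.+1%:R <= optimal_deviation k%:R + e / 3.
  by move=> k0k; apply: step; rewrite ?ler_nat.
have [k1 k01 below] := descent_eventually_below (U := fun k => optimal_deviation k%:R)
  e3 e3 U0 Smono S_unbounded stepS drop.
exists k1%:R; split; first exact: num_real.
move=> t /ltW k1t.
have [k /andP[kt tk]] := tau_piece clock0 ltr01 clock1 (le_trans (ler0n _ k1) k1t).
have k1k : (k1 <= k)%N by apply: (tau_le_of_lt ltr01 clock1); exact: le_lt_trans k1t tk.
apply: le_trans (step k t (leq_trans k01 k1k) kt (ltW tk)) _.
have {2}-> : e = e / 3 + e / 3 + e / 3 by field.
by rewrite lerD2r below.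
Qed.

End ClosedLoopBound.

(** * Consensus and optimality *)

Theorem theorem2 (R : realType) (n r : nat)
  (f : 'I_n -> 'rV[R]_r -> R) (H : 'I_n -> set 'rV[R]_r)
  (eta etabar : R) (G : R -> wdigraph R n)
  (tau : nat -> R) (d_w M : R) (ts : nat -> R)
  (x : 'I_n -> R -> 'rV[R]_r) (q : 'I_n -> R -> R)
  (f_diff : forall i (s : 'rV[R]_r), differentiable (f i) s)
  (f_convex : forall i, convex_function setT (f i))
  (H_closed : forall i, closed (H i))
  (H_convex : forall i, convex_set (H i))
  (eta_gt0 : 0 < eta) (eta_lt : eta < etabar)
  (G_adm : forall t : R, 0 <= t -> admissible eta etabar (G t))
  (G_switch : switching_times G tau)
  (G_balanced : forall t : R, 0 <= t -> balanced (G t))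
  (* (i) *)
  (X_neq0 : forall i, critical_points (f i) !=set0)
  (X_bounded : forall i, bounded_set (critical_points (f i)))
  (* (ii) *)
  (H_neq0 : \bigcap_i H i !=set0)
  (* (iii) *)
  (d_w_gt0 : 0 < d_w)
  (dwell : forall k, d_w <= tau k.+1 - tau k)
  (* (iv) *)
  (M_gt : d_w < M)
  (ts0 : ts 0%N = 0)
  (ts_switch : forall j, exists k, ts j = tau k)
  (ts_step : forall j, 0 < ts j.+1 - ts j <= M)
  (ts_conn : forall j,
     strongly_connected (union_edges G `[ts j, ts j.+1[))
  (traj : closed_loop_trajectory f H G tau x q) :
  (forall i, x i t - average x t @[t --> +oo] --> (0 : 'rV[R]_r)) /\
  (forall i,
     euclid_norm (x i t - euclid_proj (minimizers (\bigcap_i H i)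
                            (fun s => \sum_i f i s)) (average x t))
       @[t --> +oo] --> (0 : R)).
Proof.
have n_pos (i : 'I_n) : (0 < n)%N by exact: leq_ltn_trans (leq0n i) (ltn_ord i).
have [B x_bounded] : exists B, forall i t, 0 <= t -> ⟦x i t⟧ <= B.
  exact: (trajectories_bounded f_diff f_convex H_closed H_convex eta_gt0
    G_adm G_switch G_balanced X_neq0 X_bounded H_neq0 d_w_gt0 dwell traj).
split=> i; have n_gt0 := n_pos i; apply/cvgrPdist_le => e e0.
  have := near_agreement n_gt0 f_diff f_convex H_closed H_convex eta_gt0 eta_lt
    G_adm G_switch G_balanced H_neq0 d_w_gt0 dwell ts0 ts_switch ts_step
    ts_conn traj x_bounded e0.
  apply: filterS => t [_ close _ _]; rewrite sub0r normrN.
  exact: le_trans (supnorm_le_norm _) (close i).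
have e2 : 0 < e ^+ 2 by rewrite exprn_gt0.
have := optimal_deviation_vanish n_gt0 f_diff f_convex H_closed H_convex eta_gt0 eta_lt
  G_adm G_switch G_balanced X_neq0 X_bounded H_neq0 d_w_gt0 dwell ts0 ts_switch ts_step
  ts_conn traj x_bounded e2.
apply: filterS => t small; rewrite sub0r normrN ger0_norm ?norm_ge0//.
rewrite -(ler_pXn2r (n := 2)) ?nnegrE ?norm_ge0 ?(ltW e0)//.
by apply: le_trans small; exact: sqr_deviation_term.
Qed.
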